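(* There exists $k_0$ such that for every integer $k\ge k_0$, $N_{\ge}(k)\ge \frac{9}{163}k^2$.
   Context: All graphs are finite, undirected and simple; the order of a graph is its number of vertices. For a positive integer $k$, $N_{\ge}(k)$ denotes the smallest integer $n\ge 1$ such that every graph on $n$ vertices contains an induced subgraph that is regular (all vertices have the same degree) and has order at least $k$. *)

(* Defs.v *)
From mathcomp Require Import all_boot.
Set Implicit Arguments. Unset Strict Implicit. Unset Printing Implicit Defensive.

Definition simple_graph (n : nat) (e : rel 'I_n) : Prop :=
  (forall x, ~~ e x x) /\ (forall x y, e x y = e y x).

Definition induced_regular (n : nat) (e : rel 'I_n) (S : {set 'I_n}) : Prop :=
  exists d : nat, forall v, v \in S -> #|[set u in S | e v u]| = d.

Definition every_graph_has_reg (k n : nat) : Prop :=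
  forall e : rel 'I_n, simple_graph e ->
    exists S : {set 'I_n}, k <= #|S| /\ induced_regular e S.

(* N_>=(k): smallest n >= 1 with the above property.  We do not need to
   construct the minimum: "N(k) >= b" is stated as "every n >= 1 with the
   property is >= b". *)

(* Main.v *)
Require Import Defs.
From mathcomp Require Import all_boot all_order all_algebra.
From mathcomp Require Import classical_sets reals topology normedtype derive realfun sequences exp.
From mathcomp Require Import polyrcf.
From mathcomp Require Import zify ring lra.

(* Give vertex [v] a weight [w_v] in [[1/2, 2]] and make [uv] an edge
   independently with probability [w_u w_v / (1 + w_u w_v)]. In this model the
   probability of a graph depends only on its degrees, so changing all weights
   on an [m]-set [S] to a constant [x] multiplies the probability that [S]
   induces a [d]-regular graph by an explicit factor; for the constant weight,
   exposing the vertices one at a time bounds that probability by the product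
   over [j < m] of the largest atom of Binomial([j], [p]), [p = x^2/(1 + x^2)].
   By Stirling this is at most [b^m e^(m/2)] up to a polynomial in [m], where
   [b] is the central atom of Binomial([m - 1], [p]). The identity
   [(1 + x^2)(1 + uv) = (1 + xu)(1 + xv) + (u - x)(v - x)] turns the factor, up
   to harmless corrections, into a product over [v] in [S] of the relative
   binomial weight of [d] for success probability [x w_v / (1 + x w_v)].
   When the numbers [w_v^2/(1 + w_v^2)] are spaced by [delta], those
   probabilities are spaced by about [delta/2] near [p], and since
   [t -> (m-1 choose d) t^d (1-t)^(m-1-d)] has integral [1/m] the relative
   weights of all vertices add up to about [2/(delta m b)]. Summing over [S] the
   powers of [b] cancel, leaving about [(2 e^(3/2) / (delta m^2))^m]. Spreading
   the [w_v^2/(1 + w_v^2)] over [[0.21, 0.79]] allows [delta] about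
   [10.504/k^2] for [9k^2/163] vertices, which makes the base less than 1. *)

Set Implicit Arguments. Unset Strict Implicit. Unset Printing Implicit Defensive.
Import Order.TTheory GRing.Theory Num.Theory numFieldNormedType.Exports.
Local Open Scope ring_scope.

(** * Random graphs with independent edges *)

(** Expectation over a random set of indices below [j] that contains each [i] independently with
    probability [q i]. Conditioning on the largest index makes it a finite recursion without measure
    theory. *)
Fixpoint row_exp (R : realFieldType) (q : nat -> R) (j : nat) (F : seq nat -> R) : R :=
  if j is i.+1
  then (1 - q i) * row_exp q i F + q i * row_exp q i (fun A => F (i :: A))
  else F [::].

Definition add_row (g : rel nat) (n : nat) (A : seq nat) : rel nat :=
  fun u v => if u == n then v \in A else if v == n then u \in A else g u v.

(** The outermost choice is the row of the last vertex, so the graph on the earlier vertices is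
    still random when that row is known. This order drives the induction in [regular_prob_le]. *)
Fixpoint graph_exp (R : realFieldType) (q : nat -> nat -> R) (n : nat)
    (F : rel nat -> R) : R :=
  if n is v.+1
  then row_exp (q v) v (fun A => graph_exp q v (fun g => F (add_row g v A)))
  else F (fun _ _ => false).

Lemma row_exp_le (R : realFieldType) (q : nat -> R) (j : nat) (F G : seq nat -> R) :
  (forall i, 0 <= q i <= 1) ->
  (forall A, all (fun i => i < j)%N A -> F A <= G A) ->
  row_exp q j F <= row_exp q j G.
Proof.
move=> q01; elim: j F G => [|j IH] F G FG /=; first exact: FG.
have /andP[q0 q1] := q01 j.
apply: lerD; apply: ler_wpM2l; rewrite ?subr_ge0 //; apply: IH => A Aj; apply: FG.
  by apply: sub_all Aj => i /= ij; rewrite ltnS ltnW.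
by rewrite /= ltnSn /=; apply: sub_all Aj => i /= ij; rewrite ltnS ltnW.
Qed.

Lemma eq_row_exp (R : realFieldType) (q : nat -> R) (j : nat) (F G : seq nat -> R) :
  (forall A, all (fun i => i < j)%N A -> F A = G A) ->
  row_exp q j F = row_exp q j G.
Proof.
elim: j F G => [|j IH] F G FG /=; first exact: FG.
by congr (_ * _ + _ * _); apply: IH => A Aj; apply: FG; rewrite /= ?ltnSn /=;
  apply: sub_all Aj => i /= ij; rewrite ltnS ltnW.
Qed.

Lemma row_exp_cst (R : realFieldType) (q : nat -> R) (j : nat) (c : R) :
  row_exp q j (fun=> c) = c.
Proof. by elim: j => //= j ->; ring. Qed.

Lemma row_expZ (R : realFieldType) (q : nat -> R) (j : nat) (c : R) F :
  row_exp q j (fun A => c * F A) = c * row_exp q j F.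
Proof. by elim: j F => //= j IH F; rewrite (IH F) (IH (fun A => F (j :: A))); ring. Qed.

Lemma row_expD (R : realFieldType) (q : nat -> R) (j : nat) F G :
  row_exp q j (fun A => F A + G A) = row_exp q j F + row_exp q j G.
Proof.
elim: j F G => //= j IH F G.
by rewrite IH (IH (fun A => F (j :: A))); ring.
Qed.

Lemma eq_graph_exp (R : realFieldType) (q : nat -> nat -> R) n (F G : rel nat -> R) :
  (forall g, F g = G g) -> graph_exp q n F = graph_exp q n G.
Proof.
elim: n F G => [|n IH] F G FG /=; first exact: FG.
by apply: eq_row_exp => A _; apply: IH.
Qed.

Lemma graph_expD (R : realFieldType) (q : nat -> nat -> R) n F G :
  graph_exp q n (fun g => F g + G g) = graph_exp q n F + graph_exp q n G.
Proof.
elim: n F G => //= n IH F G; rewrite -row_expD.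
by apply: eq_row_exp => A _; rewrite IH.
Qed.

Lemma graph_expZ (R : realFieldType) (q : nat -> nat -> R) n (c : R) F :
  graph_exp q n (fun g => c * F g) = c * graph_exp q n F.
Proof.
elim: n F => //= n IH F; rewrite -row_expZ.
by apply: eq_row_exp => A _; rewrite IH.
Qed.

Lemma graph_exp_sum (R : realFieldType) (q : nat -> nat -> R) n (I : Type) (r : seq I)
    (F : I -> rel nat -> R) :
  graph_exp q n (fun g => \sum_(i <- r) F i g) = \sum_(i <- r) graph_exp q n (F i).
Proof.
elim: r => [|i r IH].
  rewrite big_nil (@eq_graph_exp _ _ _ _ (fun=> 0 * 0)); last first.
    by move=> g; rewrite big_nil mul0r.
  by rewrite graph_expZ mul0r.
rewrite big_cons -IH -graph_expD; apply: eq_graph_exp => g.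
by rewrite big_cons.
Qed.

(** Every outcome is built by [add_row] from rows of smaller indices, hence is loopless and
    symmetric; a bound on such graphs is enough. *)
Lemma graph_exp_ge1 (R : realFieldType) (q : nat -> nat -> R) n (F : rel nat -> R) :
  (forall v u, 0 <= q v u <= 1) ->
  (forall g, irreflexive g -> symmetric g -> 1 <= F g) -> 1 <= graph_exp q n F.
Proof.
move=> q01; elim: n F => [|n IH] F F1 /=; first exact: F1.
rewrite -[leLHS](row_exp_cst (q n) n); apply: row_exp_le => // A An.
have nA : n \notin A by apply/negP => /(allP An); rewrite ltnn.
apply: IH => g girr gsym; apply: F1 => [u|u v]; rewrite /add_row.
  by case: eqP => [->|_]; [apply: negbTE|apply: girr].
by case: (eqVneq u n) => [Eu|un]; case: (eqVneq v n) => [Ev|vn] //; rewrite ?Eu ?Ev // gsym.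
Qed.

(** * Probability that a fixed vertex set induces a regular graph *)

Definition degree_in (S : pred nat) (n : nat) (g : rel nat) (v : nat) : nat :=
  (\sum_(0 <= u < n | S u) g u v)%N.

(* [D v] is the degree that [v] has already received from later vertices. *)
Definition residual_regular (S : pred nat) (d n : nat) (D : nat -> nat) (g : rel nat) : bool :=
  all (fun v => S v ==> (D v + degree_in S n g v == d)%N) (iota 0 n).

Definition below (S : pred nat) (n : nat) : nat := count S (iota 0 n).

Lemma belowS S n : below S n.+1 = (below S n + S n)%N.
Proof. by rewrite /below -addn1 iotaD count_cat /= add0n addn0. Qed.

Lemma big_nat_recr_cond (T : Type) (idx : T) (op : Monoid.law idx) (n : nat) (P : pred nat) (F : nat -> T) :
  \big[op/idx]_(0 <= i < n.+1 | P i) F i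
  = if P n then op (\big[op/idx]_(0 <= i < n | P i) F i) (F n)
    else \big[op/idx]_(0 <= i < n | P i) F i.
Proof.
have -> : index_iota 0 n.+1 = index_iota 0 n ++ [:: n].
  by rewrite /index_iota !subn0 -addn1 iotaD.
by rewrite big_cat /= big_cons big_nil; case: (P n); rewrite Monoid.mulm1.
Qed.

(** The edge to [i] has odds [w i * y], and the factor [x / w v] of each chosen member of [S]
    changes these odds to the constant [x * y]. So only the number [d - c] of chosen members
    matters, and indices outside [S] integrate out. The indicator of [c <= d] guards the truncated
    subtraction. *)
Lemma row_exp_binomial (R : realFieldType) (S : pred nat) (w : nat -> R) (x y : R) (d j c : nat) :
  (forall i, 0 < w i) -> 0 < x -> 0 < y ->
  row_exp (fun i => w i * y / (1 + w i * y)) j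
    (fun A => (c + \sum_(0 <= u < j | S u) (u \in A) == d)%N%:R
              * \prod_(0 <= v < j | S v) (x / w v) ^+ (v \in A))
  = (c <= d)%N%:R * 'C(below S j, d - c)%:R * (x * y) ^+ (d - c)
    / \prod_(0 <= v < j | S v) (1 + w v * y).
Proof.
move=> w0 x0 y0.
have w1 i : 1 + w i * y != 0 by rewrite gt_eqF // ltr_pwDl // ltW // mulr_gt0.
elim: j c => [|j IH] c /=.
  rewrite !big_nil /= addn0 mulr1 invr1 mulr1 /below /=.
  case: (ltngtP c d) => cd; rewrite ?(mul0r, mul1r) //; last first.
    by rewrite cd subnn bin0 expr0 mulr1.
  by rewrite bin0n subn_eq0 leqNgt cd /= mul0r.
have sumE A (b : nat) : all (fun i => i < j)%N A ->
  (b + \sum_(0 <= u < j.+1 | S u) (u \in A) == d)%N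
  = (b + \sum_(0 <= u < j | S u) (u \in A) == d)%N.
  move=> Aj; rewrite big_nat_recr_cond; case: (S j) => //=.
  have -> : (j \in A) = false by apply/negbTE/negP => /(allP Aj); rewrite ltnn.
  by rewrite addn0.
have inE A i : (i < j)%N -> (i \in j :: A) = (i \in A).
  by move=> ij; rewrite in_cons ltn_eqF.
pose F (b : nat) (A : seq nat) : R := (b + \sum_(0 <= u < j | S u) (u \in A) == d)%N%:R
              * \prod_(0 <= v < j | S v) (x / w v) ^+ (v \in A).
have E1 A : all (fun i => i < j)%N A ->
  (c + \sum_(0 <= u < j.+1 | S u) (u \in A) == d)%N%:R
   * \prod_(0 <= v < j.+1 | S v) (x / w v) ^+ (v \in A) = F c A.
  move=> Aj; rewrite sumE // big_nat_recr_cond /F.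
  have -> : (j \in A) = false by apply/negbTE/negP => /(allP Aj); rewrite ltnn.
  by rewrite expr0 /= mulr1 if_same.
have E2 A : all (fun i => i < j)%N A ->
  (c + \sum_(0 <= u < j.+1 | S u) (u \in j :: A) == d)%N%:R
   * \prod_(0 <= v < j.+1 | S v) (x / w v) ^+ (v \in j :: A)
  = (if S j then x / w j else 1) * F (c + S j)%N A.
  move=> Aj; rewrite !big_nat_recr_cond /F in_cons eqxx /= expr1.
  rewrite (@congr_big_nat _ _ _ 0 j 0 j S S (fun u => (u \in j :: A) : nat) (fun u => (u \in A) : nat)) //; last first.
    by move=> i /andP[_ /andP[_ ij]]; rewrite inE.
  rewrite (@congr_big_nat _ _ _ 0 j 0 j S S (fun u => (x / w u) ^+ (u \in j :: A)) (fun u => (x / w u) ^+ (u \in A))) //; last first.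
    by move=> i /andP[_ /andP[_ ij]]; rewrite inE.
  case: (S j); last by rewrite addn0 mul1r.
  by rewrite (addnC _ 1%N) addnA mulrA mulrC.
rewrite (eq_row_exp _ E1) (eq_row_exp _ E2) row_expZ /F !IH big_nat_recr_cond belowS.
have P0 : \prod_(0 <= v < j | S v) (1 + w v * y) != 0.
  by rewrite gt_eqF // prodr_gt0 // => i _; rewrite ltr_pwDl // ltW // mulr_gt0.
case: (S j); last by rewrite !addn0 mul1r /=; field; rewrite w1 P0.
(* Pascal's rule, according to whether [j] is chosen. If [c > d] both branches vanish; if [c = d]
   only the branch that skips [j] survives. *)
rewrite !addn1; case: (ltngtP c d) => cd /=.
- have -> : (d - c = (d - c.+1).+1)%N by lia.
  rewrite binS natrD exprS; field.
  by rewrite w1 P0 gt_eqF.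
- by rewrite !mul0r !mulr0 addr0.
- rewrite cd subnn !bin0 expr0; field.
  by rewrite w1 P0 gt_eqF.
Qed.

(** Once the row of [n] is exposed, the degree constraint at [n] concerns that row alone, and the
    rest is the same kind of event on the earlier vertices with updated credits [D]. *)
Lemma residual_regularS (S : pred nat) (d n : nat) (D : nat -> nat) (g : rel nat) A :
  all (fun i => i < n)%N A ->
  residual_regular S d n.+1 D (add_row g n A)
  = if S n then (D n + \sum_(0 <= u < n | S u) (u \in A) == d)%N
                && residual_regular S d n (fun v => D v + (v \in A))%N g
    else residual_regular S d n D g.
Proof.
move=> An; have nA : (n \in A) = false.
  by apply/negbTE/negP => /(allP An); rewrite ltnn.
have degE v : (v < n)%N -> degree_in S n.+1 (add_row g n A) v
    = ((if S n then (v \in A : nat) else 0) + degree_in S n g v)%N.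
  move=> vn; rewrite /degree_in big_nat_recr_cond /=.
  rewrite (@congr_big_nat _ _ _ 0 n 0 n S S (fun u => (add_row g n A u v) : nat) (fun u => g u v : nat)) //.
    by rewrite /add_row eqxx; case: (S n); rewrite //= addnC.
  by move=> i /andP[_ /andP[_ i_n]]; rewrite /add_row !ltn_eqF.
have degn : degree_in S n.+1 (add_row g n A) n = (\sum_(0 <= u < n | S u) (u \in A))%N.
  rewrite /degree_in big_nat_recr_cond /= /add_row eqxx nA addn0 if_same.
  by apply: congr_big_nat => // i /andP[_ /andP[_ i_n]]; rewrite ltn_eqF.
rewrite /residual_regular -[X in iota 0 X]addn1 iotaD all_cat /= add0n andbT degn andbC.
case: (S n) degE => degE /=; [congr (_ && _)|]; apply: eq_in_all => v;
  rewrite mem_iota /= add0n => vn; rewrite degE //.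
by rewrite addnA.
Qed.

(** Induction on the number of vertices with arbitrary credits [D]; the product of
    [(w v / x) ^+ D v] is a potential whose change along a row is exactly what [row_exp_binomial]
    absorbs. The last hypothesis says that [a j] dominates all atoms of Binomial([j],
    [x^2 / (1 + x^2)]). *)
Lemma regular_prob_le (R : realFieldType) (S : pred nat) (w a : nat -> R) (x : R)
    (d n : nat) (D : nat -> nat) :
  (forall i, 0 < w i) -> 0 < x -> (forall j, 0 <= a j) ->
  (forall j i, 'C(j, i)%:R * x ^+ 2 ^+ i <= a j * (1 + x ^+ 2) ^+ j) ->
  graph_exp (fun v u => w u * w v / (1 + w u * w v)) n
    (fun g => (residual_regular S d n D g)%:R) * \prod_(0 <= v < n | S v) (w v / x) ^+ D v
  <= \prod_(0 <= v < n | S v)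
       ((w v / x) ^+ d * \prod_(0 <= u < v | S u) ((1 + x ^+ 2) / (1 + w u * w v))
        * a (below S v)).
Proof.
move=> w0 x0 a0 ha.
have wx0 v : 0 < w v / x by rewrite divr_gt0.
have q01 v u : 0 <= w u * w v / (1 + w u * w v) <= 1.
  have h : 0 < w u * w v by rewrite mulr_gt0.
  by rewrite divr_ge0 /= ?ler_pdivrMr ?mul1r ?lerDr //; lra.
elim: n D => [|n IH] D; first by rewrite !big_nil mulr1 /=.
rewrite /= [in leRHS]big_nat_recr_cond; set B := \prod_(0 <= v < n | S v) (_ * _ * _) in IH *.
case Sn : (S n); last first.
  rewrite big_nat_recr_cond Sn /=.
  rewrite (@eq_row_exp _ _ _ _ (fun=> graph_exp (fun v u => w u * w v / (1 + w u * w v)) n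
    (fun g => (residual_regular S d n D g)%:R))); first by rewrite row_exp_cst; exact: IH.
  by move=> A An; apply: eq_graph_exp => g; rewrite residual_regularS // Sn.
rewrite big_nat_recr_cond Sn /=.
set P := \prod_(0 <= v < n | S v) (w v / x) ^+ D v.
have P0 : 0 < P by apply: prodr_gt0 => i _; rewrite exprn_gt0.
have Q0 : 0 < \prod_(0 <= v < n | S v) (1 + w v * w n).
  by apply: prodr_gt0 => i _; rewrite ltr_pwDl // ltW // mulr_gt0.
(* For each row [A], the induction hypothesis with credits raised along [A] bounds the inner
   expectation by [B / P] times the product of [x / w v] over the members of [S] in [A]. *)
apply: (@le_trans _ _ (row_exp (fun u => w u * w n / (1 + w u * w n)) n
  (fun A => (B / P) * ((D n + \sum_(0 <= u < n | S u) (u \in A) == d)%N%:R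
              * \prod_(0 <= v < n | S v) (x / w v) ^+ (v \in A))) * (P * (w n / x) ^+ D n))).
  apply: ler_wpM2r; first by rewrite mulr_ge0 ?exprn_ge0 // ltW.
  apply: row_exp_le => [i|A An]; first exact: q01.
  rewrite (@eq_graph_exp _ _ _ _ (fun g => (D n + \sum_(0 <= u < n | S u) (u \in A) == d)%N%:R
     * (residual_regular S d n (fun v => D v + (v \in A))%N g)%:R)); last first.
    by move=> g; rewrite residual_regularS // Sn -natrM mulnb.
  rewrite graph_expZ [leRHS]mulrCA; apply: ler_wpM2l => //.
  set Q := \prod_(0 <= v < n | S v) (x / w v) ^+ (v \in A).
  have QA0 : 0 < Q by apply: prodr_gt0 => i _; rewrite exprn_gt0 // divr_gt0.
  have := IH (fun v => D v + (v \in A))%N.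
  have -> : \prod_(0 <= v < n | S v) (w v / x) ^+ (D v + (v \in A)) = P / Q.
    rewrite /P /Q -prodf_div; apply: eq_bigr => v _.
    by rewrite exprD -exprVn invf_div.
  by rewrite -ler_pdivlMr ?divr_gt0 // invf_div mulrA mulrAC.
rewrite row_expZ row_exp_binomial //.
set e := (d - D n)%N.
have hle := ha (below S n) e.
have Wn : 0 <= B.
  apply: prodr_ge0 => v _; rewrite !mulr_ge0 ?a0 ?exprn_ge0 ?(ltW (wx0 _)) //.
  apply: prodr_ge0 => u _.
  by rewrite divr_ge0 ?addr_ge0 ?mulr_ge0 ?exprn_ge0 ?(ltW (w0 _)) ?(ltW x0).
rewrite prodf_div big_const_seq iter_mulr_1 {2}/index_iota subn0.
rewrite -[count S (iota 0 n)]/(below S n).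
set Q := \prod_(0 <= v < n | S v) (1 + w v * w n) in Q0 *.
have -> : B / P * ((D n <= d)%N%:R * 'C(below S n, e)%:R * (x * w n) ^+ e / Q)
            * (P * (w n / x) ^+ D n)
  = B / Q * ((D n <= d)%N%:R * 'C(below S n, e)%:R * ((x * w n) ^+ e * (w n / x) ^+ D n)).
  by field; rewrite !gt_eqF.
have -> : B * ((w n / x) ^+ d * ((1 + x ^+ 2) ^+ below S n / Q) * a (below S n))
  = B / Q * ((w n / x) ^+ d * (a (below S n) * (1 + x ^+ 2) ^+ below S n)).
  by field; rewrite !gt_eqF.
apply: ler_wpM2l; first by rewrite divr_ge0 // ltW.
case: leqP => cd; last first.
  by rewrite !mul0r !mulr_ge0 ?exprn_ge0 ?a0 ?addr_ge0 ?exprn_ge0 ?(ltW (wx0 _)) ?(ltW x0).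
have -> : (w n / x) ^+ d = (w n / x) ^+ D n * (w n / x) ^+ e by rewrite -exprD subnKC.
have -> : (x * w n) ^+ e = (w n / x) ^+ e * x ^+ 2 ^+ e.
  by rewrite -exprMn; congr (_ ^+ _); field; rewrite gt_eqF.
rewrite mul1r; set t := w n / x.
have h0 : 0 <= t ^+ e * t ^+ D n by rewrite mulr_ge0 ?exprn_ge0 ?(ltW (wx0 _)).
have := ler_wpM2l h0 hle; congr (_ <= _); ring.
Qed.

(** * Weight of a vertex set *)

(** Vertex sets are encoded as sublists of [iota 0 n], so that the union bound is a sum over a
    list. *)
Fixpoint combs (l : seq nat) (m : nat) : seq (seq nat) :=
  if m is k.+1
  then if l is x :: l' then map (cons x) (combs l' k) ++ combs l' m else [::]
  else [:: [::]].

Lemma mem_combs (l s : seq nat) : subseq s l -> s \in combs l (size s).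
Proof.
elim: l s => [|x l IH] [|y s] //=.
rewrite mem_cat; case: eqP => [->|_] sl; last by rewrite (IH (y :: s)) // orbT.
by rewrite map_f // IH.
Qed.

Lemma combsP (l s : seq nat) (m : nat) : s \in combs l m -> subseq s l /\ size s = m.
Proof.
elim: l m s => [|x l IH] [|m] s //=; rewrite ?inE.
- by move=> /eqP ->.
- by move=> /eqP ->.
rewrite mem_cat => /orP[/mapP[t /IH[tl <-] ->]|/IH[sl <-]] /=.
  by rewrite eqxx.
split=> //; exact: subseq_trans sl (subseq_cons l x).
Qed.

Lemma exprD_ge (R : realFieldType) (s h : R) m :
  0 <= s -> 0 <= h -> s ^+ m.+1 + m.+1%:R * h * s ^+ m <= (s + h) ^+ m.+1.
Proof.
move=> s0 h0; elim: m => [|m IH]; first by rewrite !expr1 expr0; lra.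
rewrite exprS; apply: le_trans (ler_wpM2l (addr_ge0 s0 h0) IH).
have h1 : 0 <= h * (m.+1%:R * h * s ^+ m) by rewrite !mulr_ge0 // exprn_ge0.
rewrite !exprS -!natr1 in h1 *; lra.
Qed.

(** The left sum is an elementary symmetric polynomial; [m!] times it collects the squarefree terms
    of the expanded power. The induction on the list keeps the first two terms of the binomial
    expansion ([exprD_ge]). *)
Lemma sum_combs_le (R : realFieldType) (h : nat -> R) (l : seq nat) (m : nat) :
  (forall v, 0 <= h v) ->
  (\sum_(s <- combs l m) \prod_(v <- s) h v) * m`!%:R <= (\sum_(v <- l) h v) ^+ m.
Proof.
move=> h0; elim: l m => [|x l IH] [|m] /=.
- by rewrite big_seq1 big_nil fact0 mul1r expr0.
- by rewrite !big_nil mul0r expr0n.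
- by rewrite big_seq1 big_nil fact0 mul1r expr0.
rewrite big_cat big_map /= big_cons.
under eq_bigr do rewrite big_cons.
rewrite -mulr_sumr mulrDl.
set s := \sum_(v <- l) h v.
have s0 : 0 <= s by apply: sumr_ge0.
apply: (@le_trans _ _ (h x * m.+1%:R * s ^+ m + s ^+ m.+1)).
  apply: lerD; last exact: IH.
  rewrite factS natrM -!mulrA; apply: ler_wpM2l => //.
  by rewrite mulrCA; apply: ler_wpM2l => //.
rewrite addrC (addrC (h x)); apply: le_trans (exprD_ge m s0 (h0 x)).
by rewrite (mulrC (h x)).
Qed.

Lemma prod_below (R : realFieldType) (S : pred nat) (a : nat -> R) n :
  \prod_(0 <= v < n | S v) a (below S v) = \prod_(0 <= j < below S n) a j.
Proof.
elim: n => [|n IH]; first by rewrite !big_nil.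
rewrite big_nat_recr_cond belowS; case: (S n); last by rewrite addn0.
by rewrite addn1 big_nat_recr //= IH.
Qed.

Lemma prodr_below (R : realFieldType) (S : pred nat) (c : R) n :
  \prod_(0 <= u < n | S u) c = c ^+ below S n.
Proof. by rewrite big_const_seq iter_mulr_1 /index_iota subn0. Qed.

(** Each member of [S] lies in one pair fewer than the size of [S]; the extra product on the left
    avoids a subtraction in the exponent. *)
Lemma prod_pairs (R : realFieldType) (S : pred nat) (f : nat -> R) n :
  (\prod_(0 <= v < n | S v) \prod_(0 <= u < v | S u) (f u * f v))
    * \prod_(0 <= v < n | S v) f v
  = \prod_(0 <= v < n | S v) f v ^+ below S n.
Proof.
elim: n => [|n IH]; first by rewrite !big_nil mulr1.
rewrite !big_nat_recr_cond belowS; case: (S n); last by rewrite addn0.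
rewrite addn1 big_split /= prodr_below.
under [in RHS]eq_bigr do rewrite exprS.
rewrite [in RHS]big_split /= -IH exprS; ring.
Qed.

(** For [t >= 0] this follows from [(1 + t)(1 - t + t^2) = 1 + t^3]. For [t < 0] that product is
    below 1, so with [y = t^2 - t] the linear bound is applied to [y / 2] and squared. *)
Lemma expR_le_1D (R : realType) (t : R) : - 5%:R^-1 <= t -> expR (t - t ^+ 2) <= 1 + t.
Proof.
move=> ht; rewrite -[t - _]opprK expRN.
have e0 := expR_gt0 (- (t - t ^+ 2)).
rewrite -[X in X <= _]mul1r ler_pdivrMr //.
have [t0|t0] := leP 0 t.
  have h := expR_ge1Dx (- (t - t ^+ 2)).
  have h2 : 1 <= (1 + t) * (1 + - (t - t ^+ 2)).
    rewrite (_ : _ * _ = 1 + t ^+ 3); last by ring.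
    by rewrite lerDl exprn_ge0.
  by apply: le_trans h2 _; apply: ler_wpM2l => //; lra.
set y := - (t - t ^+ 2).
have y0 : 0 <= y by rewrite /y; nra.
have h := expR_ge1Dx (y / 2).
have h2 : (1 + y / 2) ^+ 2 <= expR y.
  rewrite [in leRHS](_ : y = y / 2 + y / 2); last by field.
  rewrite expRD -expr2 lerXn2r // nnegrE ?expR_ge0 //; lra.
have h3 : 1 <= (1 + t) * (1 + y / 2) ^+ 2.
  by rewrite /y; nra.
by apply: le_trans h3 _; apply: ler_wpM2l => //; lra.
Qed.

(** With [expR_le_1D] on every pair, the products [r u * r v] sum over pairs to half of the squared
    sum minus the sum of squares, and their squares sum to at most half of the squared sum of
    squares. *)
Lemma prod_pairs_expR (R : realType) (S : pred nat) (r : nat -> R) n :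
  (forall u v, - 5%:R^-1 <= r u * r v) ->
  \prod_(0 <= v < n | S v) \prod_(0 <= u < v | S u) (1 + r u * r v)^-1
  <= expR ((\sum_(0 <= v < n | S v) r v ^+ 2 - (\sum_(0 <= v < n | S v) r v) ^+ 2
            + (\sum_(0 <= v < n | S v) r v ^+ 2) ^+ 2) / 2).
Proof.
move=> hr.
elim: n => [|n IH]; first by rewrite !big_nil expr0n /= subrr add0r mul0r expR0.
rewrite !big_nat_recr_cond; case: (S n) => /=; last exact: IH.
set s1 := \sum_(0 <= v < n | S v) r v in IH *.
set s2 := \sum_(0 <= v < n | S v) r v ^+ 2 in IH *.
have pos u v : 0 < 1 + r u * r v by have := hr u v; lra.
have h : \prod_(0 <= u < n | S u) (1 + r u * r n)^-1 <= expR (- (r n * s1) + r n ^+ 2 * s2).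
  rewrite /s1 /s2 !mulr_sumr -sumrN -big_split /= expR_sum.
  apply: ler_prod => u _; rewrite invr_ge0 ltW ?pos //=.
  rewrite -[X in _ <= X]invrK lef_pV2 ?posrE ?invr_gt0 ?expR_gt0 // -expRN.
  by apply: le_trans (expR_le_1D (hr u n)); rewrite ler_expR; lra.
apply: (le_trans (ler_pM _ _ IH h)).
- by apply: prodr_ge0 => v _; apply: prodr_ge0 => u _; rewrite invr_ge0 ltW.
- by apply: prodr_ge0 => u _; rewrite invr_ge0 ltW.
rewrite -expRD ler_expR.
(* The only slack in adding vertex [n]: the square of the sum of squares also produces [r n ^+ 4],
   which belongs to no pair. *)
have r4 : 0 <= r n ^+ 4 / 2 by rewrite divr_ge0 // (exprM _ 2 2) sqr_ge0.
rewrite -subr_ge0; move: r4; by congr (_ <= _); field.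
Qed.

Lemma sqr_sum_le (R : realFieldType) (S : pred nat) (y : nat -> R) n :
  (\sum_(0 <= v < n | S v) y v) ^+ 2
  <= (below S n)%:R * \sum_(0 <= v < n | S v) y v ^+ 2.
Proof.
set s := \sum_(_ <= _ < _ | _) y _; set q := \sum_(_ <= _ < _ | _) y _ ^+ 2.
have key t : 2 * t * s <= (below S n)%:R * t ^+ 2 + q.
  have -> : (below S n)%:R * t ^+ 2 = \sum_(0 <= v < n | S v) t ^+ 2.
    by rewrite big_const_seq iter_addr_0 mulr_natl /index_iota subn0.
  rewrite /s /q mulr_sumr -big_split /=; apply: ler_sum => v _.
  have := sqr_ge0 (t - y v); nra.
have [s0|s0] := eqVneq s 0.
  rewrite s0 expr0n /= mulr_ge0 //; apply: sumr_ge0 => v _; exact: sqr_ge0.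
have [c0|c0] := posnP (below S n).
  (* An empty [S] contradicts [s != 0]: this choice of [t] turns [key] into [q + 1 <= q]. *)
  have := key ((q + 1) / (2 * s)); rewrite c0 mul0r add0r.
  have -> : 2 * ((q + 1) / (2 * s)) * s = q + 1 by field.
  lra.
have c1 : 0 < (below S n)%:R :> R by rewrite ltr0n.
have := key (s / (below S n)%:R).
set c := (below S n)%:R in c1 *.
have -> : 2 * (s / c) * s = 2 * (s ^+ 2 / c) by ring.
have -> : c * (s / c) ^+ 2 = s ^+ 2 / c by field; rewrite gt_eqF.
move=> h; have : s ^+ 2 / c <= q by lra.
by rewrite ler_pdivrMr // mulrC.
Qed.

(* If [x = tan a] and [w = tan b], then [tangent x w = tan (b - a)]. *)
Definition tangent (R : realType) (x w : R) : R := (w - x) / (1 + x * w).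

(** In angles: cos(b - c) = cos(b - a) cos(c - a) (1 + tan(b - a) tan(c - a)). The factor of a pair
    splits into one factor per endpoint and a correction of second order in the tangents. *)
Lemma pair_identity (R : realType) (x u v : R) :
  0 < x -> 0 < u -> 0 < v ->
  (1 + x ^+ 2) / (1 + u * v)
  = (1 + x ^+ 2) / (1 + x * u) * ((1 + x ^+ 2) / (1 + x * v))
    * (1 + tangent x u * tangent x v)^-1.
Proof.
move=> x0 u0 v0; rewrite /tangent.
have a : 0 < 1 + x * u by rewrite addr_gt0 // mulr_gt0.
have b : 0 < 1 + x * v by rewrite addr_gt0 // mulr_gt0.
have c : 0 < 1 + u * v by rewrite addr_gt0 // mulr_gt0.
have d : 0 < 1 + x ^+ 2 by rewrite addr_gt0 // exprn_gt0.
have -> : 1 + (u - x) / (1 + x * u) * ((v - x) / (1 + x * v))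
  = (1 + x ^+ 2) * (1 + u * v) / ((1 + x * u) * (1 + x * v)).
  by field; rewrite !gt_eqF.
by field; rewrite !gt_eqF.
Qed.

(** Each vertex lies in [m] pairs, whence the power [m]. In the bound of [prod_pairs_expR] the
    squared sum of tangents enters negatively and is dropped, and Cauchy-Schwarz ([sqr_sum_le])
    replaces the squared sum of squares by [m.+1] times the sum of fourth powers, which makes the
    correction a product over vertices. *)
Lemma regular_weight_le (R : realType) (S : pred nat) (w : nat -> R) (x : R) (d n m : nat) :
  below S n = m.+1 -> 0 < x -> (forall v, 0 < w v) ->
  (forall u v, - 5%:R^-1 <= tangent x (w u) * tangent x (w v)) ->
  \prod_(0 <= v < n | S v)
     ((w v / x) ^+ d * \prod_(0 <= u < v | S u) ((1 + x ^+ 2) / (1 + w u * w v)))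
  <= \prod_(0 <= v < n | S v)
     ((w v / x) ^+ d * ((1 + x ^+ 2) / (1 + x * w v)) ^+ m
      * expR (tangent x (w v) ^+ 2 / 2 + m.+1%:R * tangent x (w v) ^+ 4 / 2)).
Proof.
move=> Sm x0 w0 hr.
pose f v := (1 + x ^+ 2) / (1 + x * w v); pose r v := tangent x (w v).
have f0 v : 0 < f v by rewrite divr_gt0 // addr_gt0 // ?exprn_gt0 ?mulr_gt0.
have pairE : \prod_(0 <= v < n | S v) \prod_(0 <= u < v | S u) ((1 + x ^+ 2) / (1 + w u * w v))
  = (\prod_(0 <= v < n | S v) f v ^+ m)
    * \prod_(0 <= v < n | S v) \prod_(0 <= u < v | S u) (1 + r u * r v)^-1.
  have -> : \prod_(0 <= v < n | S v) f v ^+ m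
    = \prod_(0 <= v < n | S v) \prod_(0 <= u < v | S u) (f u * f v).
    have P0 : 0 < \prod_(0 <= v < n | S v) f v by apply: prodr_gt0.
    apply: (mulIf (lt0r_neq0 P0)); rewrite prod_pairs Sm -big_split /=.
    by apply: eq_bigr => v _; rewrite exprSr.
  rewrite -big_split /=; apply: eq_bigr => v _.
  by rewrite -big_split /=; apply: eq_bigr => u _; exact: pair_identity.
rewrite big_split /= pairE big_split /= big_split /= -!mulrA.
apply: ler_wpM2l; first by apply: prodr_ge0 => v _; rewrite exprn_ge0 // divr_ge0 // ltW.
apply: ler_wpM2l; first by apply: prodr_ge0 => v _; rewrite exprn_ge0 // ltW.
apply: le_trans (prod_pairs_expR S n hr) _.
rewrite -expR_sum ler_expR big_split /= -!mulr_suml -mulr_sumr.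
have := sqr_sum_le S (fun v => r v ^+ 2) n; rewrite Sm.
have -> : \sum_(0 <= v < n | S v) r v ^+ 2 ^+ 2 = \sum_(0 <= v < n | S v) r v ^+ 4.
  by apply: eq_bigr => v _; rewrite -exprM.
have := sqr_ge0 (\sum_(0 <= v < n | S v) r v).
rewrite -/r; lra.
Qed.

(** * The union bound *)

(** Contribution of one vertex of a set of size [N.+1] to the probability bound; the exponential is
    its share of the pair corrections. *)
Definition tilted_weight (R : realType) (w : nat -> R) (x : R) (d N v : nat) : R :=
  (w v / x) ^+ d * ((1 + x ^+ 2) / (1 + x * w v)) ^+ N
  * expR (tangent x (w v) ^+ 2 / 2 + N.+1%:R * tangent x (w v) ^+ 4 / 2).

Lemma regular_prob_tilted (R : realType) (S : pred nat) (w a : nat -> R) (x : R) (d n N : nat) :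
  below S n = N.+1 -> (forall i, 0 < w i) -> 0 < x -> (forall j, 0 <= a j) ->
  (forall j i, 'C(j, i)%:R * x ^+ 2 ^+ i <= a j * (1 + x ^+ 2) ^+ j) ->
  (forall u v, - 5%:R^-1 <= tangent x (w u) * tangent x (w v)) ->
  graph_exp (fun v u => w u * w v / (1 + w u * w v)) n
    (fun g => (residual_regular S d n (fun=> 0%N) g)%:R)
  <= \prod_(0 <= v < n | S v) tilted_weight w x d N v * \prod_(0 <= j < N.+1) a j.
Proof.
move=> SN w0 x0 a0 ha hr.
have := @regular_prob_le R S w a x d n (fun=> 0%N) w0 x0 a0 ha.
rewrite big1 ?mulr1 => [h|v _]; last by rewrite expr0.
apply: (le_trans h); rewrite big_split /= prod_below SN.
apply: ler_wpM2r; first by apply: prodr_ge0.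
exact: regular_weight_le.
Qed.

Lemma filter_combs (n m : nat) (s : seq nat) :
  s \in combs (iota 0 n) m -> [seq v <- iota 0 n | v \in s] = s.
Proof.
move=> /combsP[sub _]; apply/esym/eqP.
by have /subseq_uniqP := sub => /(_ (iota_uniq 0 n)) /eqP.
Qed.

Lemma big_combs (R : realFieldType) (n m : nat) (s : seq nat) (h : nat -> R) :
  s \in combs (iota 0 n) m -> \prod_(0 <= v < n | v \in s) h v = \prod_(v <- s) h v.
Proof.
by move=> sn; rewrite -big_filter /index_iota subn0 (filter_combs sn).
Qed.

Lemma below_combs (n m : nat) (s : seq nat) :
  s \in combs (iota 0 n) m -> below (fun v => v \in s) n = m.
Proof.
move=> sn; rewrite /below -size_filter (filter_combs sn).
by have [_] := combsP sn.
Qed.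

Lemma regular_subset_combs (n k : nat) (g : rel nat) :
  (0 < k)%N -> irreflexive g -> symmetric g -> every_graph_has_reg k n ->
  exists m d s, [/\ (k <= m <= n)%N, (d < m)%N, s \in combs (iota 0 n) m
    & residual_regular (fun v => v \in s) d n (fun=> 0%N) g].
Proof.
move=> k0 girr gsym reg.
have [|S [kS [d dS]]] := reg (fun u v : 'I_n => g u v).
  by split=> [u|u v]; rewrite ?girr // gsym.
pose s := [seq val v | v <- enum S].
have sS (v : 'I_n) : (val v \in s) = (v \in S).
  by rewrite mem_map ?mem_enum //; exact: val_inj.
exists #|S|, d, s; split.
- by rewrite kS /= -[X in (_ <= X)%N](card_ord n) max_card.
- have /card_gt0P[v vS] : (0 < #|S|)%N by apply: leq_trans kS.
  rewrite -(dS v vS); apply: proper_card; apply/properP; split.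
    by apply/fintype.subsetP => u; rewrite inE => /andP[].
  by exists v => //; rewrite inE vS girr.
- have -> : #|S| = size s by rewrite size_map -cardE.
  apply: mem_combs; rewrite -val_enum_ord; apply: map_subseq.
  by rewrite [enum 'I_n]enumT filter_subseq.
- apply/allP => v; rewrite mem_iota /= add0n => vn; apply/implyP => vs.
  have vS : Ordinal vn \in S by rewrite -sS.
  rewrite add0n -(dS _ vS) /degree_in big_mkord -sum1_card; apply/eqP.
  rewrite big_mkcond [RHS]big_mkcond /=; apply: eq_bigr => u _.
  by rewrite sS inE gsym; case: (u \in S) => //=; case: (g _ _).
Qed.

Lemma le_sum_mem (R : realFieldType) (I : eqType) (r : seq I) (F : I -> R) (i : I) :
  (forall j, 0 <= F j) -> i \in r -> F i <= \sum_(j <- r) F j.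
Proof.
move=> F0; elim: r => [//|j r IH]; rewrite in_cons big_cons => /predU1P[->|/IH h].
  by rewrite lerDl sumr_ge0.
by apply: le_trans h _; rewrite lerDr.
Qed.

(** First moment method. If every graph had such a subgraph, the expected number of triples of size,
    degree and set would be at least 1; but at most [n.+1 ^ 2] pairs of size and degree occur, each
    contributing at most [c]. The parameters [x] and [a] may depend on size and degree, not on the
    set. *)
Lemma no_regular (R : realType) (w : nat -> R) (k n : nat) :
  (0 < k)%N -> (forall v, 0 < w v) ->
  (forall N d, (k <= N.+1 <= n)%N -> (d <= N)%N -> exists (x : R) (a : nat -> R),
    [/\ 0 < x,
        forall u v, - 5%:R^-1 <= tangent x (w u) * tangent x (w v),
        forall j, 0 <= a j,
        forall j i, 'C(j, i)%:R * x ^+ 2 ^+ i <= a j * (1 + x ^+ 2) ^+ j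
      & (\prod_(0 <= j < N.+1) a j) * (\sum_(0 <= v < n) tilted_weight w x d N v) ^+ N.+1
        / N.+1`!%:R <= (n.+1%:R ^+ 2 + 1)^-1]) ->
  ~ every_graph_has_reg k n.
Proof.
move=> k0 w0 H reg.
pose q v u := w u * w v / (1 + w u * w v).
pose ind (d : nat) (s : seq nat) (g : rel nat) : R := (residual_regular (fun v => v \in s) d n (fun=> 0%N) g)%:R.
pose F g := \sum_(m <- [seq m <- iota 0 n.+1 | (k <= m)%N]) \sum_(d <- iota 0 m)
  \sum_(s <- combs (iota 0 n) m) ind d s g.
have F1 : 1 <= graph_exp q n F.
  apply: graph_exp_ge1 => [v u|g girr gsym].
    have h : 0 < w u * w v by rewrite mulr_gt0.
    by rewrite divr_ge0 /= ?ler_pdivrMr ?mul1r ?lerDr //; lra.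
  have [m [d [s [/andP[km mn] dm sm rs]]]] := regular_subset_combs k0 girr gsym reg.
  have i0 d' s' : 0 <= ind d' s' g by rewrite ler0n.
  have mk : m \in [seq m <- iota 0 n.+1 | (k <= m)%N].
    by rewrite mem_filter km mem_iota /= add0n ltnS.
  have dk : d \in iota 0 m by rewrite mem_iota.
  apply: le_trans (le_sum_mem _ mk); last first.
    by move=> m'; apply: sumr_ge0 => d' _; apply: sumr_ge0.
  apply: le_trans (le_sum_mem _ dk); last by move=> d'; apply: sumr_ge0.
  by apply: le_trans (le_sum_mem _ sm) => //; rewrite /ind rs.
pose c : R := (n.+1%:R ^+ 2 + 1)^-1.
have c0 : 0 < c by rewrite invr_gt0 ltr_pwDr // sqr_ge0.
have bound m d : (k <= m <= n)%N -> (d < m)%N ->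
    graph_exp q n (fun g => \sum_(s <- combs (iota 0 n) m) ind d s g) <= c.
  case: m => [|N]; first by rewrite leqNgt k0.
  move=> kN dN; have [x [a [x0 hr a0 ha hc]]] := H N d kN dN.
  rewrite graph_exp_sum; apply: le_trans hc.
  have A0 : 0 <= \prod_(0 <= j < N.+1) a j by apply: prodr_ge0.
  have h0 v : 0 <= tilted_weight w x d N v.
    rewrite !mulr_ge0 ?expR_ge0 ?exprn_ge0 ?divr_ge0 ?addr_ge0 ?mulr_ge0 ?exprn_ge0 //;
      by rewrite ltW.
  apply: (@le_trans _ _ (\sum_(s <- combs (iota 0 n) N.+1)
     (\prod_(0 <= j < N.+1) a j) * \prod_(v <- s) tilted_weight w x d N v)).
    rewrite big_seq [leRHS]big_seq; apply: ler_sum => s sn.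
    rewrite -(big_combs _ sn) mulrC.
    apply: regular_prob_tilted => //; exact: below_combs sn.
  rewrite -mulr_sumr -mulrA; apply: ler_wpM2l => //.
  rewrite ler_pdivlMr ?ltr0n ?fact_gt0 //.
  have := sum_combs_le (iota 0 n) N.+1 h0.
  by rewrite /index_iota subn0.
move: F1; rewrite /F graph_exp_sum => F1.
suff : \sum_(m <- [seq m <- iota 0 n.+1 | (k <= m)%N]) \sum_(d <- iota 0 m) c < 1.
  apply/negP; rewrite -leNgt; apply: le_trans F1 _.
  rewrite big_seq [leRHS]big_seq; apply: ler_sum => m.
  rewrite mem_filter mem_iota /= add0n ltnS => km.
  rewrite graph_exp_sum big_seq [leRHS]big_seq; apply: ler_sum => d.
  by rewrite mem_iota /= add0n => dm; apply: bound.
apply: (@le_lt_trans _ _ (\sum_(m <- iota 0 n.+1) n.+1%:R * c)).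
  rewrite big_filter big_mkcond /= big_seq [leRHS]big_seq; apply: ler_sum => m.
  rewrite -[0%N :: _]/(iota 0 n.+1) mem_iota /= add0n ltnS => mn.
  case: ifP => _; last by rewrite mulr_ge0 // ltW.
  rewrite big_const_seq iter_addr_0 count_predT size_iota -[c *+ _]mulr_natl.
  by rewrite ler_pM2r // ler_nat leqW.
rewrite big_const_seq iter_addr_0 count_predT size_iota -[(_ * c) *+ _]mulr_natl mulrA -expr2.
by rewrite ltr_pdivrMr ?mul1r ?ltrDl // ltr_pwDr // sqr_ge0.
Qed.

(** * Exponential and Stirling estimates *)

(** The mean value theorem reduces a Taylor bound to one for the derivative; [c] and [x] lie on the
    same side of 0, which controls the sign of the product. *)
Lemma expR_horner_mvt (R : realType) (p : {poly R}) (x : R) :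
  p.[0] = 1 ->
  exists c, (0 <= c <= x \/ x <= c <= 0)
    /\ expR x - p.[x] = (expR c - p^`().[c]) * x.
Proof.
move=> p0.
pose f := expR \- horner p.
have df (y : R) : is_derive y 1 f (expR y - p^`().[y]) by exact: is_deriveB.
have cf a b : {within `[a, b]%classic, continuous f}%classic.
  apply: derivable_within_continuous => y _; exact: ex_derive.
have [x0|x0] := leP 0 x.
  have [c] := MVT_segment x0 (fun y _ => df y) (cf 0 x).
  rewrite in_itv /= => cx; rewrite /f /= expR0 p0 subrr !subr0 => E.
  by exists c; split; [left|].
have [c] := MVT_segment (ltW x0) (fun y _ => df y) (cf x 0).
rewrite in_itv /= => cx; rewrite /f /= expR0 p0 subrr !sub0r => E.
by exists c; split; [right|rewrite -[LHS]opprK E mulrN opprK].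
Qed.

Lemma expR_ge_cubic (R : realType) (x : R) :
  1 + x + x ^+ 2 / 2 + x ^+ 3 / 6 <= expR x.
Proof.
have quad (y : R) : exists2 c, 0 <= c & expR y - (1 + y + y ^+ 2 / 2) = c * y.
  pose p : {poly R} := 1 + 'X + 2^-1 *: 'X^2.
  have pE z : p.[z] = 1 + z + z ^+ 2 / 2 by rewrite !hornerE /=; field.
  have p0 : p.[0] = 1 by rewrite pE !expr0n /= !mul0r !addr0.
  have [c [_ E]] := expR_horner_mvt y p0.
  exists (expR c - p^`().[c]); last by rewrite -E pE.
  have -> : p^`().[c] = 1 + c by rewrite /p !poly.derivE !hornerE /=; field.
  have := expR_ge1Dx c; lra.
pose p : {poly R} := 1 + 'X + 2^-1 *: 'X^2 + 6^-1 *: 'X^3.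
have pE z : p.[z] = 1 + z + z ^+ 2 / 2 + z ^+ 3 / 6.
  by rewrite !hornerE /=; field.
have p0 : p.[0] = 1 by rewrite pE !expr0n /= !mul0r !addr0.
have [c [cx E]] := expR_horner_mvt x p0.
rewrite -pE -subr_ge0 E.
have [e e0 ce] := quad c.
have -> : p^`().[c] = 1 + c + c ^+ 2 / 2 by rewrite /p !poly.derivE !hornerE /=; field.
rewrite ce.
rewrite -mulrA; apply: mulr_ge0 => //.
case: cx => /andP[h1 h2]; first by rewrite mulr_ge0 // (le_trans h1).
by rewrite mulr_le0 // (le_trans h1).
Qed.

(** Quadratic upper bound for log(1 + a). The coefficient 1/4 in place of the Taylor value 1/2 buys
    validity up to 3/2, the largest argument met in [rel_atom_le_expR]. *)
Lemma onedD_le_expR (R : realType) (a : R) :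
  0 <= a <= 3%:R / 2 -> 1 + a <= expR (a - a ^+ 2 / 4).
Proof.
move=> /andP[a0 a1]; apply: le_trans (expR_ge_cubic _).
rewrite -subr_ge0.
have -> : 1 + (a - a ^+ 2 / 4) + (a - a ^+ 2 / 4) ^+ 2 / 2 + (a - a ^+ 2 / 4) ^+ 3 / 6 - (1 + a)
  = a ^+ 2 * ((1 - a / 4) ^+ 2 / 2 + a * (1 - a / 4) ^+ 3 / 6 - 4^-1) by field.
apply: mulr_ge0; first exact: sqr_ge0.
(* In the variable [s] the range becomes [[5/8, 1]]; the constant 25/64 below is the square of its
   left end. *)
pose s := 1 - a / 4; have -> : a = 4 * (1 - s) by rewrite /s; field.
have -> : 1 - 4 * (1 - s) / 4 = s by field.
have s1 : 5 / 8 <= s <= 1 by rewrite /s; lra.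
have h : 0 <= (s ^+ 2 - 25 / 64) * (s * (1 - s)).
  by apply: mulr_ge0; [nra|apply: mulr_ge0; lra].
have -> : s ^+ 2 / 2 + 4 * (1 - s) * s ^+ 3 / 6 - 4^-1
  = 2 / 3 * ((s ^+ 2 - 25 / 64) * (s * (1 - s))) + (23 / 96 * s ^+ 2 + 25 / 96 * s - 4^-1).
  by field.
by apply: addr_ge0; [lra|nra].
Qed.

Lemma onedB_le_expR (R : realType) (b : R) :
  0 <= b <= 1 -> 1 - b <= expR (- b - b ^+ 2 / 2).
Proof.
move=> /andP[b0 b1]; apply: le_trans (expR_ge_cubic _).
rewrite -subr_ge0.
have -> : 1 + (- b - b ^+ 2 / 2) + (- b - b ^+ 2 / 2) ^+ 2 / 2
    + (- b - b ^+ 2 / 2) ^+ 3 / 6 - (1 - b)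
  = b ^+ 3 * (2^-1 + b / 8 - (1 + b / 2) ^+ 3 / 6) by field.
apply: mulr_ge0; first exact: exprn_ge0.
have h : 0 <= b * (1 - b) by apply: mulr_ge0; lra.
have h2 : 0 <= b * (b * (1 - b)) by apply: mulr_ge0.
nra.
Qed.

(** The cubic minorant at -1/4 equals 299/384, and its 12th power is at least 4/81. Division by 25
    later turns 81/4 into the base 81/100. *)
Lemma expR3_le (R : realType) : expR 3 <= 81 / 4 :> R.
Proof.
have h0 : 299 / 384 <= expR (- 4^-1) :> R by apply: le_trans (expR_ge_cubic _); lra.
have -> : expR 3 = (expR (- 4^-1) ^+ 12)^-1 :> R.
  by rewrite -expRM_natl -expRN; congr expR; field.
rewrite -[leRHS]invrK lef_pV2 ?posrE ?invr_gt0 ?exprn_gt0 ?expR_gt0 //; last lra.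
apply: le_trans (_ : (299 / 384) ^+ 12 <= _); first lra.
by apply: lerXn2r; rewrite ?nnegrE ?expR_ge0 //; lra.
Qed.

(* Square of [n! / (sqrt n * (n / e) ^ n)], which decreases to [2 * pi]. *)
Definition stirling_ratio (R : realType) (n : nat) : R :=
  n`!%:R ^+ 2 * expR (2 * n%:R) / n%:R ^+ (2 * n).+1.

Lemma stirling_ratio_gt0 (R : realType) n : (0 < n)%N -> 0 < stirling_ratio R n.
Proof.
by move=> n0; rewrite divr_gt0 ?mulr_gt0 ?expR_gt0 ?exprn_gt0 ?ltr0n ?fact_gt0.
Qed.

Lemma stirling_ratioS (R : realType) n : (0 < n)%N ->
  stirling_ratio R n = stirling_ratio R n.+1
    * ((n.+1%:R / n%:R) ^+ (2 * n).+1 / expR 2).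
Proof.
move=> n0; rewrite /stirling_ratio factS natrM.
have n1 : n%:R != 0 :> R by rewrite pnatr_eq0 -lt0n.
have n2 : n.+1%:R != 0 :> R by rewrite pnatr_eq0.
have -> : expR (2 * n.+1%:R) = expR (2 * n%:R) * expR 2 :> R.
  by rewrite -expRD -[n.+1%:R]natr1; congr expR; ring.
have -> : (2 * n.+1).+1 = ((2 * n).+1 + 2)%N by lia.
rewrite expr_div_n [n.+1%:R ^+ (_ + 2)]exprD.
have : expR 2 != 0 :> R by rewrite gt_eqF ?expR_gt0.
move: (expR 2) => e e0; move: (expR _) => f.
have A0 := expf_neq0 (2 * n).+1 n1; have B0 := expf_neq0 (2 * n).+1 n2.
set A := n%:R ^+ _ in A0 *; set B := n.+1%:R ^+ (2 * n).+1 in B0 *.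
set b := n.+1%:R in n2 *; clearbody A B b; field.
by rewrite e0 A0 B0 n2.
Qed.

Lemma stirling_ratio_decr (R : realType) n :
  (0 < n)%N -> stirling_ratio R n.+1 <= stirling_ratio R n.
Proof.
move=> n0; rewrite (stirling_ratioS R n0) ler_pMr ?stirling_ratio_gt0 //.
rewrite ler_pdivlMr ?expR_gt0 // mul1r.
have n1 : 1 <= n%:R :> R by rewrite ler1n.
(* With this [y] the quotient [(n + 1) / n] is [(1 + y) / (1 - y)], whose logarithm is at least
   [2 * y], and the exponent [2 * n + 1] is [1 / y]. *)
pose y : R := (2 * n%:R + 1)^-1.
have -> : expR 2 = expR (2 * y) ^+ (2 * n).+1.
  rewrite -expRM_natl -[(2 * n).+1%:R]natr1 natrM; congr expR; rewrite /y; field.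
  by apply: lt0r_neq0; lra.
apply: lerXn2r; rewrite ?nnegrE ?expR_ge0 ?divr_ge0 //.
have y0 : 0 < y by rewrite invr_gt0; lra.
have y1 : y <= 1 / 3.
  rewrite /y -[X in X <= _]mul1r ler_pdivrMr; lra.
have -> : n.+1%:R / n%:R = (1 + y) / (1 - y).
  rewrite /y -[n.+1%:R]natr1; field.
  by rewrite ?lt0r_neq0 //; lra.
rewrite -[leRHS]invrK -[leLHS]invrK lef_pV2 ?posrE ?invr_gt0 ?expR_gt0 //; last first.
  by rewrite divr_gt0; lra.
rewrite invf_div -expRN; apply: le_trans (expR_ge_cubic _).
rewrite ler_pdivrMr; last lra.
nra.
Qed.

(** Converse of the monotonicity, from log((1 + y) / (1 - y)) <= 2 y + 8 y^3 for [y <= 1/3]. The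
    error is written as a difference so that it telescopes in [stirling_ratio_ge]. *)
Lemma stirling_ratio_lower (R : realType) n : (0 < n)%N ->
  stirling_ratio R n <= stirling_ratio R n.+1 * expR (2 / n%:R - 2 / n.+1%:R).
Proof.
move=> n0; rewrite (stirling_ratioS R n0) ler_pM2l ?stirling_ratio_gt0 //.
rewrite ler_pdivrMr ?expR_gt0 // -expRD.
have n1 : 1 <= n%:R :> R by rewrite ler1n.
pose y : R := (2 * n%:R + 1)^-1.
have y0 : 0 < y by rewrite invr_gt0; lra.
have y1 : y <= 1 / 3.
  rewrite /y -[X in X <= _]mul1r ler_pdivrMr; lra.
have yn : n%:R = (1 - y) / (2 * y).
  by rewrite /y; field; rewrite ?lt0r_neq0 //; lra.
apply: (@le_trans _ _ (expR (2 * y + 8 * y ^+ 3) ^+ (2 * n).+1)).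
  apply: lerXn2r; rewrite ?nnegrE ?expR_ge0 ?divr_ge0 //.
  rewrite -[n.+1%:R]natr1 yn; apply: le_trans (expR_ge_cubic _).
  have -> : ((1 - y) / (2 * y) + 1) / ((1 - y) / (2 * y)) = (1 + y) / (1 - y).
    by field; apply/andP; split; apply: lt0r_neq0; lra.
  rewrite ler_pdivrMr; last lra.
  pose z := 2 * y + 8 * y ^+ 3.
  have y3 : 0 <= y ^+ 3 by rewrite exprn_ge0 // ltW.
  have z2 : (2 * y) ^+ 2 <= z ^+ 2 by apply: lerXn2r; rewrite ?nnegrE /z; lra.
  have z3 : (2 * y) ^+ 3 <= z ^+ 3 by apply: lerXn2r; rewrite ?nnegrE /z; lra.
  apply: (@le_trans _ _ ((1 + 2 * y + 2 * y ^+ 2 + 28 / 3 * y ^+ 3) * (1 - y))).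
    rewrite -subr_ge0.
    have -> : (1 + 2 * y + 2 * y ^+ 2 + 28 / 3 * y ^+ 3) * (1 - y) - (1 + y)
      = y ^+ 3 * (22 / 3 - 28 / 3 * y) by field.
    by apply: mulr_ge0 => //; lra.
  apply: ler_wpM2r; first lra.
  rewrite -/z; move: z2 z3; rewrite /z !exprMn; lra.
rewrite -expRM_natl ler_expR -[(2 * n).+1%:R]natr1 natrM -[n.+1%:R]natr1 yn -subr_ge0.
have -> : 2 / ((1 - y) / (2 * y)) - 2 / ((1 - y) / (2 * y) + 1) + 2
    - (2 * ((1 - y) / (2 * y)) + 1) * (2 * y + 8 * y ^+ 3) = 8 * y ^+ 4 / (1 - y ^+ 2).
  field; rewrite ?lt0r_neq0 //; nra.
rewrite divr_ge0 ?mulr_ge0 ?exprn_ge0 ?(ltW y0) //; nra.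
Qed.

Lemma stirling_ratio_le (R : realType) i d :
  (0 < i <= d)%N -> stirling_ratio R d <= stirling_ratio R i.
Proof.
move=> /andP[i0]; elim: d => [|d IH]; first by rewrite leqn0 => /eqP i00; rewrite i00 in i0.
rewrite leq_eqVlt => /predU1P[->//|id].
by apply: le_trans (IH id); apply: stirling_ratio_decr; exact: leq_trans i0 id.
Qed.

Lemma stirling_ratio_ge (R : realType) j d : (0 < j <= d)%N ->
  stirling_ratio R j <= stirling_ratio R d * expR (2 / j%:R).
Proof.
move=> /andP[j0 jd].
have : stirling_ratio R j <= stirling_ratio R d * expR (2 / j%:R - 2 / d%:R).
  elim: d jd => [|d IH]; first by rewrite leqn0 => /eqP j00; rewrite j00 in j0.
  rewrite leq_eqVlt => /predU1P[<-|jd]; first by rewrite subrr expR0 mulr1.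
  apply: (le_trans (IH jd)).
  have -> : 2 / j%:R - 2 / d.+1%:R = (2 / d%:R - 2 / d.+1%:R) + (2 / j%:R - 2 / d%:R) :> R.
    by ring.
  rewrite [in leRHS]expRD mulrA; apply: ler_wpM2r; first exact: expR_ge0.
  by apply: stirling_ratio_lower; exact: leq_trans j0 jd.
move=> h; apply: (le_trans h); apply: ler_wpM2l.
  by rewrite ltW // stirling_ratio_gt0 // (leq_trans j0).
by rewrite ler_expR gerBl divr_ge0.
Qed.

(** * Largest atoms of binomial distributions *)

Definition atom (R : realType) (p : R) (j i : nat) : R :=
  'C(j, i)%:R * p ^+ i * (1 - p) ^+ (j - i).

Lemma atom_ge0 (R : realType) (p : R) j i : 0 <= p <= 1 -> 0 <= atom p j i.
Proof. by move=> /andP[p0 p1]; rewrite !mulr_ge0 ?exprn_ge0 ?subr_ge0. Qed.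

Lemma sum_atom (R : realType) (p : R) j : \sum_(i < j.+1) atom p j i = 1.
Proof.
transitivity (((1 - p) + p) ^+ j); last by rewrite subrK expr1n.
rewrite exprDn; apply: eq_bigr => i _; rewrite /atom -mulr_natl; ring.
Qed.

Lemma atom_le1 (R : realType) (p : R) j i : 0 <= p <= 1 -> atom p j i <= 1.
Proof.
move=> p01; have [ij|ij] := ltnP i j.+1; last by rewrite /atom bin_small // !mul0r.
rewrite -(sum_atom p j) (bigD1 (Ordinal ij)) //= lerDl.
by apply: sumr_ge0 => k _; exact: atom_ge0.
Qed.

(** Exact Stirling form: the exponentials in the three ratios cancel. Squaring avoids square roots
    of [i], [k] and [i + k]. *)
Lemma atom_sqrE (R : realType) (p : R) i k : (0 < i)%N -> (0 < k)%N ->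
  atom p (i + k) i ^+ 2
  = stirling_ratio R (i + k) / (stirling_ratio R i * stirling_ratio R k)
    * ((i + k)%:R / (i%:R * k%:R))
    * ((p * (i + k)%:R / i%:R) ^+ i * ((1 - p) * (i + k)%:R / k%:R) ^+ k) ^+ 2.
Proof.
move=> i0 k0; rewrite /atom addKn.
have binE : 'C(i + k, i)%:R = (i + k)`!%:R / (i`!%:R * k`!%:R) :> R.
  have := bin_fact (leq_addr k i); rewrite addKn => <-.
  by rewrite !natrM mulfK // mulf_neq0 // pnatr_eq0 -lt0n fact_gt0.
rewrite binE /stirling_ratio.
have -> : expR (2 * (i + k)%:R) = expR (2 * i%:R) * expR (2 * k%:R) :> R.
  by rewrite natrD mulrDr expRD.
have j1 : (i + k)%:R != 0 :> R by rewrite pnatr_eq0; lia.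
have i1 : i%:R != 0 :> R by rewrite pnatr_eq0 -lt0n.
have k1 : k%:R != 0 :> R by rewrite pnatr_eq0 -lt0n.
have fi : i`!%:R != 0 :> R by rewrite pnatr_eq0 -lt0n fact_gt0.
have fk : k`!%:R != 0 :> R by rewrite pnatr_eq0 -lt0n fact_gt0.
have ei : expR (2 * i%:R) != 0 :> R by rewrite gt_eqF ?expR_gt0.
have ek : expR (2 * k%:R) != 0 :> R by rewrite gt_eqF ?expR_gt0.
rewrite !expr_div_n !exprMn !exprVn -!exprM ![(_ * 2)%N]mulnC !exprS mulnDr exprD.
have Ai := expf_neq0 (2 * i) i1; have Ak := expf_neq0 (2 * k) k1.
have Bi := expf_neq0 (2 * i) j1; have Bk := expf_neq0 (2 * k) j1.
set ji := (i + k)%:R ^+ (2 * i) in Bi *; set jk := (i + k)%:R ^+ (2 * k) in Bk *.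
set ii := i%:R ^+ (2 * i) in Ai *; set kk := k%:R ^+ (2 * k) in Ak *.
set j := (i + k)%:R in j1 *; set e := expR _ in ei *; set f := expR _ in ek *.
set a := i`!%:R in fi *; set b := k`!%:R in fk *.
set ir := i%:R in i1 *; set kr := k%:R in k1 *.
clearbody ji jk ii kk j e f a b ir kr.
field.
by rewrite ?j1 ?Ai ?Ak ?Bi ?Bk ?fi ?fk ?ei ?ek ?i1 ?k1.
Qed.

(** From [x <= expR (x - 1)]: the exponents add up to at most 0. *)
Lemma weighted_amgm (R : realType) (a b : R) i k :
  0 <= a -> 0 <= b -> i%:R * a + k%:R * b <= i%:R + k%:R -> a ^+ i * b ^+ k <= 1.
Proof.
move=> a0 b0 h.
have hx (x : R) : x <= expR (x - 1) by have := expR_ge1Dx (x - 1); lra.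
have := ler_pM (exprn_ge0 i a0) (exprn_ge0 k b0)
  (lerXn2r i _ _ (hx a)) (lerXn2r k _ _ (hx b)).
rewrite !nnegrE !expR_ge0 a0 b0 -!expRM_natl -expRD => H.
apply: le_trans (H isT isT isT isT) _.
by rewrite expR_le1; lra.
Qed.

Lemma atom_sqr_le (R : realType) (p : R) i k : (0 < i)%N -> (0 < k)%N -> 0 <= p <= 1 ->
  atom p (i + k) i ^+ 2
  <= stirling_ratio R (i + k) / (stirling_ratio R i * stirling_ratio R k)
    * ((i + k)%:R / (i%:R * k%:R)).
Proof.
move=> i0 k0 /andP[p0 p1]; rewrite atom_sqrE //.
rewrite ler_piMr //.
  have pos n : (0 < n)%N -> 0 <= stirling_ratio R n by move=> n0; exact/ltW/stirling_ratio_gt0.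
  by apply: mulr_ge0; apply: divr_ge0; rewrite ?pos ?addn_gt0 ?i0 //; apply: mulr_ge0;
    rewrite ?pos.
have i1 : i%:R != 0 :> R by rewrite pnatr_eq0 -lt0n.
have k1 : k%:R != 0 :> R by rewrite pnatr_eq0 -lt0n.
rewrite expr_le1 //; last first.
  by rewrite mulr_ge0 ?exprn_ge0 ?divr_ge0 ?mulr_ge0 ?subr_ge0.
apply: weighted_amgm; rewrite ?divr_ge0 ?mulr_ge0 ?subr_ge0 //.
rewrite natrD le_eqVlt; apply/orP; left; apply/eqP; field.
by rewrite i1 k1.
Qed.

Lemma atom_mean_sqr (R : realType) D k : (0 < D)%N -> (0 < k)%N ->
  atom (D%:R / (D + k)%:R) (D + k) D ^+ 2
  = stirling_ratio R (D + k) / (stirling_ratio R D * stirling_ratio R k)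
    * ((D + k)%:R / (D%:R * k%:R)).
Proof.
move=> D0 k0; rewrite atom_sqrE //.
have D1 : D%:R != 0 :> R by rewrite pnatr_eq0 -lt0n.
have k1 : k%:R != 0 :> R by rewrite pnatr_eq0 -lt0n.
have N1 : (D + k)%:R != 0 :> R by rewrite pnatr_eq0; lia.
have -> : D%:R / (D + k)%:R * (D + k)%:R / D%:R = 1 :> R by rewrite divfK // divff.
have -> : (1 - D%:R / (D + k)%:R) * (D + k)%:R / k%:R = 1 :> R.
  by rewrite natrD in N1 *; field; rewrite k1 N1.
by rewrite !(expr1n, mulr1).
Qed.

(** At success probability [D / (D + K)] the atom at [D] is given exactly by [atom_mean_sqr], while
    the other is bounded by [atom_sqr_le]. Passing from [i], [k] to [D], [K] lowers the Stirling
    ratios in the denominator, and the numerator is controlled by [stirling_ratio_ge]. *)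
Lemma atom_cmp (R : realType) D K i k :
  (0 < i <= D)%N -> (0 < k <= K)%N ->
  atom (D%:R / (D + K)%:R : R) (i + k) i ^+ 2
  <= atom (D%:R / (D + K)%:R) (D + K) D ^+ 2
     * (D%:R * K%:R / (D + K)%:R) * ((i + k)%:R / (i%:R * k%:R)) * expR (2 / (i + k)%:R).
Proof.
move=> /andP[i0 iD] /andP[k0 kK].
have D0 := leq_trans i0 iD; have K0 := leq_trans k0 kK.
have p01 : 0 <= (D%:R / (D + K)%:R : R) <= 1.
  by rewrite divr_ge0 //= ler_pdivrMr ?mul1r ?ler_nat ?leq_addr // ltr0n addn_gt0 D0.
apply: (le_trans (atom_sqr_le i0 k0 p01)).
rewrite atom_mean_sqr //.
have Di := @stirling_ratio_le R i D; have Kk := @stirling_ratio_le R k K.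
rewrite i0 in Di; rewrite k0 in Kk; move: (Di iD) (Kk kK) => {}Di {}Kk.
have hj : (0 < i + k <= D + K)%N by rewrite addn_gt0 i0 leq_add.
have Jj := stirling_ratio_ge R hj.
have si := stirling_ratio_gt0 R i0; have sk := stirling_ratio_gt0 R k0.
have sD := stirling_ratio_gt0 R D0; have sK := stirling_ratio_gt0 R K0.
have sN : 0 < stirling_ratio R (D + K) by apply: stirling_ratio_gt0; rewrite addn_gt0 D0.
have D1 : D%:R != 0 :> R by rewrite pnatr_eq0 -lt0n.
have K1 : K%:R != 0 :> R by rewrite pnatr_eq0 -lt0n.
have N1 : (D + K)%:R != 0 :> R by rewrite pnatr_eq0 -lt0n addn_gt0 D0.
have alg (s e a x y d k' n : R) : x != 0 -> y != 0 -> d != 0 -> k' != 0 -> n != 0 ->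
    s / (x * y) * (n / (d * k')) * (d * k' / n) * a * e = s * e / (x * y) * a.
  by move=> x0 y0 d0 k'0 n0; field; rewrite x0 y0 d0 k'0 n0.
rewrite alg //; try by rewrite gt_eqF.
apply: ler_wpM2r; first by rewrite divr_ge0 // mulr_ge0.
apply: ler_pM => //.
- by rewrite ltW // stirling_ratio_gt0 // addn_gt0 i0.
- by rewrite invr_ge0 mulr_ge0 // ltW.
rewrite lef_pV2 ?posrE; try exact: mulr_gt0.
by apply: ler_pM => //; exact: ltW.
Qed.

Lemma atom_step (R : realType) (p : R) j i : (i < j)%N ->
  atom p j i.+1 * (i.+1%:R * (1 - p)) = atom p j i * ((j - i)%:R * p).
Proof.
move=> ij; rewrite /atom.
have binE : i.+1%:R * 'C(j, i.+1)%:R = (j - i)%:R * 'C(j, i)%:R :> R.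
  by rewrite -!natrM mul_bin_left.
have -> : (1 - p) ^+ (j - i) = (1 - p) * (1 - p) ^+ (j - i.+1).
  by rewrite -exprS; congr (_ ^+ _); lia.
rewrite [p ^+ i.+1]exprS.
transitivity (i.+1%:R * 'C(j, i.+1)%:R * (p * p ^+ i * (1 - p) ^+ (j - i.+1) * (1 - p))).
  by ring.
by rewrite binE; ring.
Qed.

Lemma atom_up (R : realType) (p : R) j i : 0 < p < 1 -> (i < j)%N ->
  i.+1%:R <= j.+1%:R * p -> atom p j i <= atom p j i.+1.
Proof.
move=> /andP[p0 p1] ij h.
have q0 : 0 < i.+1%:R * (1 - p) by rewrite mulr_gt0 ?subr_gt0.
rewrite -(ler_pM2r q0) atom_step //; apply: ler_wpM2l.
  by rewrite atom_ge0 // !ltW.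
rewrite natrB ?(ltnW ij) //; move: h; rewrite -[j.+1%:R]natr1 -[i.+1%:R]natr1; lra.
Qed.

Lemma atom_down (R : realType) (p : R) j i : 0 < p < 1 ->
  j.+1%:R * p <= i.+1%:R -> atom p j i.+1 <= atom p j i.
Proof.
move=> /andP[p0 p1] h; have p01 : 0 <= p <= 1 by rewrite !ltW.
have [ij|ij] := ltnP i j; last by rewrite {1}/atom bin_small // !mul0r atom_ge0.
have q0 : 0 < i.+1%:R * (1 - p) by rewrite mulr_gt0 ?subr_gt0.
rewrite -(ler_pM2r q0) atom_step //; apply: ler_wpM2l.
  by rewrite atom_ge0.
rewrite natrB ?(ltnW ij) //; move: h; rewrite -[j.+1%:R]natr1 -[i.+1%:R]natr1; lra.
Qed.

(** The classical mode of Binomial([j], [D / N]), the integer part of [(j + 1) D / N]. *)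
Definition mode (D N j : nat) : nat := (j.+1 * D) %/ N.

Lemma mode_leq D N j : (D < N)%N -> (mode D N j <= j)%N.
Proof. by move=> DN; rewrite -ltnS ltn_divLR ?(leq_trans _ DN) // ltn_pmul2l. Qed.

Lemma mode_max (R : realType) D N j i : (0 < D < N)%N ->
  atom (D%:R / N%:R : R) j i <= atom (D%:R / N%:R) j (mode D N j).
Proof.
move=> /andP[D0 DN]; set p : R := _ / _; set m := mode D N j.
have N0 : (0 < N)%N by apply: leq_trans DN.
have NR : 0 < N%:R :> R by rewrite ltr0n.
have p01 : 0 < p < 1 by rewrite divr_gt0 ?ltr0n //= ltr_pdivrMr ?mul1r ?ltr_nat.
have mj : (m <= j)%N by exact: mode_leq.
have mlo : m%:R <= j.+1%:R * p.
  by rewrite mulrA ler_pdivlMr // -!natrM ler_nat leq_divM.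
have mhi : j.+1%:R * p <= m.+1%:R.
  by rewrite mulrA ler_pdivrMr // -!natrM ler_nat ltnW // ltn_ceil.
have [im|im] := leqP i m.
  have -> : i = (m - (m - i))%N by rewrite subKn.
  elim: (m - i)%N (leq_subr i m) => [|k IH] km; first by rewrite subn0.
  apply: le_trans (IH (ltnW km)).
  have -> : (m - k = (m - k.+1).+1)%N by rewrite subnSK.
  apply: atom_up => //; first by apply: leq_trans mj; rewrite ltn_subrL /= (leq_trans _ km).
  by apply: le_trans mlo; rewrite ler_nat subnSK // leq_subr.
have -> : i = (m + (i - m))%N by rewrite subnKC ?(ltnW im).
elim: (i - m)%N => [|k IH]; first by rewrite addn0.
rewrite addnS; apply: le_trans IH; apply: atom_down => //.
by apply: (le_trans mhi); rewrite ler_nat ltnS leq_addr.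
Qed.

Lemma mode_mean D N : (D < N)%N -> mode D N N = D.
Proof.
move=> DN; have N0 : (0 < N)%N by apply: leq_trans DN.
by rewrite /mode mulSn addnC mulnC divnMDl // ?divn_small ?addn0.
Qed.

Lemma atom_mean_ge (R : realType) D N : (0 < D < N)%N ->
  1 <= N.+1%:R * atom (D%:R / N%:R : R) N D.
Proof.
move=> DN; have /andP[_ DN'] := DN.
rewrite -[X in X <= _](sum_atom (D%:R / N%:R) N).
apply: (@le_trans _ _ (\sum_(i < N.+1) atom (D%:R / N%:R) N D)).
  by apply: ler_sum => i _; have := mode_max R N i DN; rewrite mode_mean.
by rewrite sumr_const card_ord -[leLHS]mulr_natl lexx.
Qed.

(** The central atom scales like the inverse square root of the number of trials. In the exponent
    22, the Stirling error gives 2, and rounding the mode and its complement gives 10 each, since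
    both are at least [j / 10] when the success probability lies in [[1/5, 4/5]]. *)
Lemma mode_sqr_le (R : realType) D N j : (N <= 5 * D)%N -> (5 * D <= 4 * N)%N ->
  (10 <= j < N)%N ->
  atom (D%:R / N%:R : R) j (mode D N j) ^+ 2
  <= atom (D%:R / N%:R) N D ^+ 2 * (N%:R / j%:R) * expR (22 / j%:R).
Proof.
move=> h5 h4 /andP[j10 jN].
have N0 : (0 < N)%N by lia.
have D0 : (0 < D)%N by lia.
have DN : (D < N)%N by lia.
set i := mode D N j.
have ilo : (i * N <= j.+1 * D)%N by exact: leq_divM.
have ihi : (j.+1 * D < i.+1 * N)%N by exact: ltn_ceil.
have i1 : (j < 5 * i.+1)%N by nia.
have i2 : (5 * i <= 4 * j.+1)%N by nia.
have iD : (i <= D)%N by nia.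
have kK : (j - i <= N - D)%N by nia.
pose k := (j - i)%N; pose K := (N - D)%N.
have jE : j = (i + k)%N by lia.
have NE : N = (D + K)%N by lia.
have hi : (0 < i <= D)%N by lia.
have hk : (0 < k <= K)%N by lia.
have := @atom_cmp R D K i k hi hk; rewrite -jE -NE => h; apply: (le_trans h).
clear h.
have b0 : 0 <= atom (D%:R / N%:R : R) N D ^+ 2 by exact: sqr_ge0.
move: (atom _ N D ^+ 2) b0 => B b0; rewrite -!mulrA; apply: ler_wpM2l => //.
have i3 : (j <= 10 * i)%N by lia.
have k3 : (j <= 10 * k)%N by lia.
have dj : (j * D <= N * i.+1)%N by nia.
have kj : (j * K <= N * k.+1)%N by nia.
have NR : 0 < N%:R :> R by rewrite ltr0n.
have jR : 0 < j%:R :> R by rewrite ltr0n; lia.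
have iR : 0 < i%:R :> R by rewrite ltr0n; lia.
have kR : 0 < k%:R :> R by rewrite ltr0n; lia.
have e (t : nat) : (j <= 10 * t)%N -> (0 < t)%N -> t.+1%:R <= t%:R * expR (10 / j%:R) :> R.
  move=> jt t0; have tR : 0 < t%:R :> R by rewrite ltr0n.
  have hx := expR_ge1Dx (10 / j%:R : R).
  apply: (@le_trans _ _ (t%:R * (1 + 10 / j%:R))); last by rewrite ler_pM2l.
  rewrite -natr1 mulrDr mulr1 lerD2l mulrA ler_pdivlMr // mul1r -natrM ler_nat mulnC.
  exact: jt.
have ei := e i i3 (proj1 (andP hi)); have ek := e k k3 (proj1 (andP hk)).
have -> : expR (22 / j%:R) = expR (10 / j%:R) * expR (10 / j%:R) * expR (2 / j%:R) :> R.
  by rewrite -!expRD; congr expR; field; rewrite gt_eqF.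
rewrite !mulrA; apply: ler_wpM2r; first exact: expR_ge0.
have dj' : j%:R * D%:R <= N%:R * (i%:R * expR (10 / j%:R)) :> R.
  apply: (@le_trans _ _ (N%:R * i.+1%:R)); first by rewrite -!natrM ler_nat.
  by rewrite ler_pM2l.
have kj' : j%:R * K%:R <= N%:R * (k%:R * expR (10 / j%:R)) :> R.
  apply: (@le_trans _ _ (N%:R * k.+1%:R)); first by rewrite -!natrM ler_nat.
  by rewrite ler_pM2l.
have := ler_pM _ _ dj' kj'; rewrite !mulr_ge0 // => /(_ isT isT).
move: (expR (10 / j%:R)) (D%:R : R) (K%:R : R) NR jR iR kR.
move: (N%:R : R) (j%:R : R) (i%:R : R) (k%:R : R) => n a b c x d f n0 a0 b0' c0 H.
have -> : d * f / n * a / (b * c) = (a * d * (a * f)) / (n * a * b * c).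
  by field; rewrite !gt_eqF.
have -> : n / a * x * x = (n * (b * x) * (n * (c * x))) / (n * a * b * c).
  by field; rewrite !gt_eqF.
by apply: ler_wpM2r H; rewrite invr_ge0 !mulr_ge0 // ltW.
Qed.
Lemma expR_inv_le (R : realType) t : (0 < t)%N -> expR (t.+1%:R^-1) <= t.+1%:R / t%:R :> R.
Proof.
move=> t0; have tR : 0 < t%:R :> R by rewrite ltr0n.
have t1 : 0 < t.+1%:R :> R by rewrite ltr0n.
have h := expR_ge1Dx (- t.+1%:R^-1 : R).
rewrite -[leLHS]invrK -expRN -[leRHS]invrK lef_pV2 ?posrE ?invr_gt0 ?divr_gt0 ?expR_gt0 //.
apply: le_trans h; rewrite invf_div le_eqVlt; apply/orP; left; apply/eqP.
rewrite -[t.+1%:R]natr1; field; apply: lt0r_neq0; lra.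
Qed.

Lemma exprn_fact_le_expR (R : realType) n : n%:R ^+ n / n`!%:R <= expR n%:R :> R.
Proof.
case: n => [|n]; first by rewrite expr0 fact0 divr1 expR0.
by apply: le_trans (expR_ge1Dxn n (ler0n _ _)); rewrite lerDr.
Qed.

(** The factors [N / j] multiply to [N^N / N!], at most [expR N]; the errors [expR (22 / j)]
    telescope through [expR_inv_le] to a 22nd power. For [j <= 9] only [B * M ^+ 2 >= 1] is used, at
    the cost of [M ^+ 18], and one more such factor raises [B ^+ N] to [B ^+ N.+1]: 42 = 22 + 18 +
    2. *)
Lemma prod_mode_sqr_le (R : realType) D N : (10 <= N)%N ->
  (N <= 5 * D)%N -> (5 * D <= 4 * N)%N ->
  (\prod_(0 <= j < N.+1) atom (D%:R / N%:R : R) j (mode D N j)) ^+ 2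
  <= N.+1%:R ^+ 42 * (atom (D%:R / N%:R) N D ^+ 2) ^+ N.+1 * expR N%:R.
Proof.
move=> N10 h5 h4.
have N0 : (0 < N)%N by apply: leq_trans N10.
have DN : (0 < D < N)%N by lia.
have NR : 0 < N%:R :> R by rewrite ltr0n.
have p01 : 0 <= (D%:R / N%:R : R) <= 1.
  by rewrite divr_ge0 //= ler_pdivrMr ?mul1r ?ler_nat // ltnW //; case/andP: DN.
have bM := atom_mean_ge R DN.
have aN : atom (D%:R / N%:R : R) N (mode D N N) = atom (D%:R / N%:R) N D.
  by rewrite mode_mean //; case/andP: DN.
have astep j := @mode_sqr_le R D N j h5 h4.
pose a j : R := atom (D%:R / N%:R) j (mode D N j).
have a0 j : 0 <= a j by exact: atom_ge0.
have a1 j : a j ^+ 2 <= 1 by rewrite expr_le1 // atom_le1.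
set b : R := atom _ N D in bM aN astep *; set B := b ^+ 2; set M : R := N.+1%:R in bM *.
have b0 : 0 <= b by exact: atom_ge0.
have B0 : 0 <= B by exact: sqr_ge0.
have M0 : 0 < M by rewrite ltr0n.
have NM : N%:R <= M by rewrite ler_nat.
have M1 : 1 <= M by rewrite ler1n.
have BM : 1 <= B * M ^+ 2.
  by rewrite -exprMn exprn_ege1 // mulrC.
rewrite -prodrXl -/a.
pose Q t := \prod_(0 <= j < t.+1) a j ^+ 2.
pose G t : R := B ^+ t * N%:R ^+ t / t`!%:R.
have G0 t : 0 <= G t by rewrite divr_ge0 // mulr_ge0 // exprn_ge0 // ltW.
have GS t : G t.+1 = G t * (B * (N%:R / t.+1%:R)).
  rewrite /G factS natrM !exprS.
  have t1 : t.+1%:R != 0 :> R by rewrite pnatr_eq0.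
  have f1 : t`!%:R != 0 :> R by rewrite pnatr_eq0 -lt0n fact_gt0.
  move: (t.+1%:R : R) (t`!%:R : R) t1 f1 => u f u0 f0; field.
  by rewrite u0 f0.
have QS t : Q t.+1 = Q t * a t.+1 ^+ 2 by rewrite /Q big_nat_recr.
have Q0 t : 0 <= Q t by apply: prodr_ge0 => j _; exact: sqr_ge0.
have small t : (t <= 9)%N -> Q t <= G t * (M ^+ 2) ^+ t.
  elim: t => [_|t IH t9].
    rewrite /Q big_nat1; apply: (le_trans (a1 0)).
    by rewrite /G fact0 !expr0 !mulr1 invr1 mulr1.
  rewrite QS GS [(M ^+ 2) ^+ _]exprSr.
  have -> : G t * (B * (N%:R / t.+1%:R)) * ((M ^+ 2) ^+ t * M ^+ 2)
    = (G t * (M ^+ 2) ^+ t) * ((B * M ^+ 2) * (N%:R / t.+1%:R)) by ring.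
  apply: ler_pM => //; [exact: sqr_ge0|exact: IH (ltnW t9)|].
  apply: le_trans (a1 _) _; rewrite -[X in X <= _]mulr1; apply: ler_pM => //.
  by rewrite ler_pdivlMr ?ltr0n // mul1r ler_nat (leq_trans _ N10) // ltnW.
have large s : (9 + s < N)%N -> Q (9 + s)%N <= G (9 + s)%N * (M ^+ 2) ^+ 9 * (9 + s)%:R ^+ 22.
  elim: s => [_|s IH sN].
    rewrite addn0; apply: le_trans (small 9 (leqnn _)) _.
    apply: ler_peMr; last by rewrite exprn_ege1 // ler1n.
    by apply: mulr_ge0 => //; apply: exprn_ge0; exact: sqr_ge0.
  rewrite addnS in sN *; rewrite QS GS.
  have tR : 0 < (9 + s)%:R :> R by rewrite ltr0n.
  set t := (9 + s)%N in IH sN tR *.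
  have -> : G t * (B * (N%:R / t.+1%:R)) * (M ^+ 2) ^+ 9 * t.+1%:R ^+ 22
    = (G t * (M ^+ 2) ^+ 9 * t%:R ^+ 22) * (B * (N%:R / t.+1%:R) * (t.+1%:R / t%:R) ^+ 22).
    rewrite expr_div_n; have := expf_neq0 22 (lt0r_neq0 tR).
    move: (t%:R ^+ 22) (t.+1%:R ^+ 22) => u v u0; field; rewrite u0 /=.
    by rewrite addrC natr1 pnatr_eq0.
  apply: ler_pM => //; [exact: sqr_ge0|exact: IH (ltnW sN)|].
  have tN : (10 <= t.+1 < N)%N by rewrite sN andbT ltnS leq_addr.
  apply: le_trans (astep _ tN) _; apply: ler_wpM2l.
    by rewrite mulr_ge0 // divr_ge0.
  rewrite expRM_natl; apply: lerXn2r; rewrite ?nnegrE ?expR_ge0 ?divr_ge0 //.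
  by apply: expR_inv_le.
have [s sE] : exists s, N = (9 + s).+1 by exists (N - 10)%N; lia.
have QN : Q N <= G N * (M ^+ 2) ^+ 9 * M ^+ 22.
  rewrite [in leLHS]sE QS -sE [a N]aN -/B.
  have -> : G N = G (9 + s)%N * B by rewrite [in LHS]sE GS -sE divff ?mulr1 // lt0r_neq0.
  have -> : G (9 + s)%N * B * (M ^+ 2) ^+ 9 * M ^+ 22
    = G (9 + s)%N * (M ^+ 2) ^+ 9 * M ^+ 22 * B by ring.
  apply: ler_wpM2r => //; apply: le_trans (large s _) _; first by rewrite [ltnRHS]sE.
  apply: ler_wpM2l; first by apply: mulr_ge0 => //; apply: exprn_ge0; exact: sqr_ge0.
  apply: lerXn2r; rewrite ?nnegrE ?ler0n ?(ltW M0) //.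
  by apply: le_trans NM; rewrite ler_nat [leqRHS]sE.
apply: (le_trans QN).
have GN : G N <= B ^+ N * expR N%:R.
  rewrite /G -mulrA; apply: ler_wpM2l; first exact: exprn_ge0.
  exact: exprn_fact_le_expR.
apply: (@le_trans _ _ (B ^+ N * expR N%:R * M ^+ 40)).
  rewrite -mulrA -exprM -exprD; apply: ler_wpM2r => //.
  by rewrite exprn_ge0 // ltW.
have -> : M ^+ 42 * B ^+ N.+1 * expR N%:R = B ^+ N * expR N%:R * M ^+ 40 * (B * M ^+ 2).
  by rewrite [B ^+ N.+1]exprS; ring.
apply: ler_peMr => //; apply: mulr_ge0; last exact/exprn_ge0/ltW.
by apply: mulr_ge0; [exact: exprn_ge0|exact: expR_ge0].
Qed.

(** * Sums of binomial atoms over a grid of probabilities *)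

(** The beta integral as a polynomial identity: the binomial likelihood has integral
    [1 / (D + k + 1)] over [[0, 1]]. Induction on [k] is integration by parts. *)
Lemma binomial_antiderivative (R : realType) (D k : nat) :
  exists T : {poly R}, [/\ T.[0] = 0, T.[1] = 1
    & forall t, T^`().[t] = (D + k).+1%:R * ('C(D + k, D)%:R * t ^+ D * (1 - t) ^+ k)].
Proof.
elim: k D => [|k IH] D.
  exists ('X ^+ D.+1); split=> [||t].
  - by rewrite hornerXn expr0n.
  - by rewrite hornerXn expr1n.
  by rewrite poly.derivXn hornerMn hornerXn addn0 binn expr0 mulr1 mul1r mulr_natl.
have [T [T0 T1 T']] := IH D.+1.
(* The added boundary term vanishes at 0 and at 1, and its derivative changes the likelihood of
   [D.+1] successes into that of [D]. *)
exists (T + 'C((D + k.+1).+1, D.+1)%:R *: ('X ^+ D.+1 * (1 - 'X) ^+ k.+1)); split=> [||t].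
- by rewrite hornerD hornerZ hornerM hornerXn T0 expr0n /= mul0r mulr0 addr0.
- by rewrite hornerD hornerZ hornerM horner_exp !hornerE T1 subrr expr0n /= !mulr0 addr0.
rewrite !poly.derivE !(hornerE, horner_exp) T' /=.
have e1 : (D + k.+1).+1%:R * 'C(D + k.+1, D)%:R = 'C((D + k.+1).+1, D.+1)%:R * D.+1%:R :> R.
  by rewrite -!natrM mul_bin_diag mulnC.
have e2 : (D + k.+1).+1%:R * 'C(D + k.+1, D.+1)%:R = 'C((D + k.+1).+1, D.+1)%:R * k.+1%:R :> R.
  by rewrite -!natrM; congr (_%:R); rewrite [RHS]mulnC mul_bin_down; congr (_ * _)%N; lia.
rewrite addSnnS !mulrA e1 e2 poly.deriv_exp !hornerMn !hornerXn hornerM horner_exp.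
rewrite !poly.derivE !hornerE /= !exprS; ring.
Qed.

(** The likelihood of [D] successes in [D + k] trials divided by its maximum over [t], attained at
    [D / (D + k)]. *)
Definition rel_atom (R : realType) (D k : nat) (t : R) : R :=
  (t * (D + k)%:R / D%:R) ^+ D * ((1 - t) * (D + k)%:R / k%:R) ^+ k.

Lemma rel_atom_ge0 (R : realType) (D k : nat) (t : R) : 0 <= t <= 1 -> 0 <= rel_atom D k t.
Proof.
move=> /andP[t0 t1]; apply: mulr_ge0; apply: exprn_ge0; apply: divr_ge0 => //.
  by rewrite mulr_ge0.
by rewrite mulr_ge0 ?subr_ge0.
Qed.

(** The sign hypothesis places [t] between [s] and the peak [D / (D + k)]; the quotient of the two
    values is then at most 1 by [weighted_amgm]. *)
Lemma rel_atom_le (R : realType) (D k : nat) (s t : R) : (0 < D)%N -> (0 < k)%N ->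
  0 < s < 1 -> 0 < t < 1 -> (t - s) * (D%:R - (D + k)%:R * t) >= 0 ->
  rel_atom D k s <= rel_atom D k t.
Proof.
move=> D0 k0 /andP[s0 s1] /andP[t0 t1] h.
have DR : 0 < D%:R :> R by rewrite ltr0n.
have kR : 0 < k%:R :> R by rewrite ltr0n.
have NR : 0 < (D + k)%:R :> R by rewrite natrD addr_gt0.
have -> : rel_atom D k s = rel_atom D k t * ((s / t) ^+ D * ((1 - s) / (1 - t)) ^+ k).
  rewrite /rel_atom mulrACA -!exprMn; congr (_ ^+ _ * _ ^+ _); field.
    by rewrite !gt_eqF.
  by rewrite !gt_eqF ?subr_gt0.
rewrite ler_piMr //.
  by rewrite mulr_ge0 // exprn_ge0 // divr_ge0 ?mulr_ge0 ?subr_ge0 ?ltW.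
apply: weighted_amgm; [by rewrite divr_ge0 // ltW|by rewrite divr_ge0 ?subr_ge0 // ltW|].
rewrite -subr_ge0.
have -> : D%:R + k%:R - (D%:R * (s / t) + k%:R * ((1 - s) / (1 - t)))
  = (t - s) * (D%:R - (D + k)%:R * t) / (t * (1 - t)).
  by rewrite natrD; field; rewrite !gt_eqF ?subr_gt0.
by rewrite divr_ge0 // mulr_ge0 ?subr_ge0 // ltW.
Qed.

Lemma rel_atom_mean (R : realType) (D k : nat) : (0 < D)%N -> (0 < k)%N ->
  rel_atom D k (D%:R / (D + k)%:R : R) = 1.
Proof.
move=> D0 k0; have DR : D%:R != 0 :> R by rewrite pnatr_eq0 -lt0n.
have kR : k%:R != 0 :> R by rewrite pnatr_eq0 -lt0n.
have NR : (D + k)%:R != 0 :> R by rewrite pnatr_eq0 -lt0n addn_gt0 D0.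
rewrite /rel_atom divfK // divff // expr1n mul1r.
have -> : (1 - D%:R / (D + k)%:R) * (D + k)%:R / k%:R = 1 :> R.
  by rewrite mulrBl mul1r divfK // natrD [_ + k%:R]addrC addrK divff.
by rewrite expr1n.
Qed.

Lemma atom_rel (R : realType) (D k : nat) (t : R) : (0 < D)%N -> (0 < k)%N ->
  'C(D + k, D)%:R * t ^+ D * (1 - t) ^+ k
  = atom (D%:R / (D + k)%:R) (D + k) D * rel_atom D k t.
Proof.
move=> D0 k0; have DR : D%:R != 0 :> R by rewrite pnatr_eq0 -lt0n.
have kR : k%:R != 0 :> R by rewrite pnatr_eq0 -lt0n.
have NR : (D + k)%:R != 0 :> R by rewrite pnatr_eq0 -lt0n addn_gt0 D0.
rewrite /atom /rel_atom addKn.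
have -> : 1 - D%:R / (D + k)%:R = k%:R / (D + k)%:R :> R.
  by rewrite -[X in X - _](divff NR) -mulrBl natrD [_ + k%:R]addrC addrK.
have -> : t ^+ D = (D%:R / (D + k)%:R) ^+ D * (t * (D + k)%:R / D%:R) ^+ D.
  by rewrite -exprMn natrD; congr (_ ^+ _); field; rewrite DR -natrD NR.
have -> : (1 - t) ^+ k = (k%:R / (D + k)%:R) ^+ k * ((1 - t) * (D + k)%:R / k%:R) ^+ k.
  by rewrite -exprMn natrD; congr (_ ^+ _); field; rewrite kR -natrD NR.
ring.
Qed.

Lemma rel_atom_antiderivative (R : realType) (D k : nat) : (0 < D)%N -> (0 < k)%N ->
  exists T : R -> R, [/\ T 0 = 0, T 1 = 1
    & forall s t c : R, 0 <= s -> s <= t -> t <= 1 ->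
      (forall u : R, s <= u <= t -> c <= rel_atom D k u) ->
      c * (t - s) * ((D + k).+1%:R * atom (D%:R / (D + k)%:R) (D + k) D) <= T t - T s].
Proof.
move=> D0 k0; have [T [T0 T1 T']] := binomial_antiderivative R D k.
exists (fun t => T.[t]); split=> // s t c s0 st t1 hc.
move: st; rewrite le_eqVlt => /predU1P[<-|st]; first by rewrite !subrr mulr0 mul0r.
have [u ust ->] := poly_mvt T st.
rewrite T' atom_rel //.
set m := (D + k).+1%:R; set b := atom _ _ _.
have mb : 0 <= m * b.
  rewrite mulr_ge0 // atom_ge0 // divr_ge0 //= ler_pdivrMr ?ltr0n ?addn_gt0 ?D0 //.
  by rewrite mul1r ler_nat leq_addr.
have ts : 0 <= t - s by rewrite subr_ge0 ltW.
have := hc u; rewrite !(itvP ust) => /(_ isT) cu.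
have := ler_wpM2l (mulr_ge0 mb ts) cu.
by congr (_ <= _); ring.
Qed.

(** Integral comparison for a unimodal function: a near term left of the peak is charged to the gap
    on its right, one right of the peak to the gap on its left. The two terms around the peak are
    bounded by 1 each, whence the 2. *)
Lemma spaced_sum_le (R : realType) (D k n : nat) (t : nat -> R) (near : pred nat) (h : R) :
  (0 < D)%N -> (0 < k)%N -> 0 < h ->
  (forall v, 0 < t v < 1) -> (forall v, (v.+1 < n)%N -> t v <= t v.+1) ->
  (forall v, (v.+1 < n)%N -> near v -> t v.+1 <= D%:R / (D + k)%:R -> h <= t v.+1 - t v) ->
  (forall v, (v.+1 < n)%N -> near v.+1 -> D%:R / (D + k)%:R <= t v -> h <= t v.+1 - t v) ->
  \sum_(0 <= v < n | near v) rel_atom D k (t v)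
  <= 2 + (h * (D + k).+1%:R * atom (D%:R / (D + k)%:R) (D + k) D)^-1.
Proof.
move=> D0 k0 h0 t01 tinc hl hr.
set p := D%:R / (D + k)%:R in hl hr *; set b := atom _ _ _.
have DR : 0 < D%:R :> R by rewrite ltr0n.
have kR : 0 < k%:R :> R by rewrite ltr0n.
have NR : 0 < (D + k)%:R :> R by rewrite natrD addr_gt0.
have p01 : 0 < p < 1.
  by rewrite divr_gt0 //= ltr_pdivrMr // mul1r natrD ltrDl.
have b0 : 0 < b.
  rewrite /b /atom addKn !mulr_gt0 ?exprn_gt0 ?subr_gt0 ?ltr0n ?bin_gt0 ?leq_addr //;
    by case/andP: p01.
have [T [T0 T1 HT]] := rel_atom_antiderivative R D0 k0.
rewrite -/p -/b in HT.
have g0 (s : R) : 0 < s < 1 -> 0 <= rel_atom D k s.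
  by move=> /andP[s0 s1]; rewrite rel_atom_ge0 // !ltW.
have g1 (s : R) : 0 < s < 1 -> rel_atom D k s <= 1.
  move=> s01; apply: (@le_trans _ _ (rel_atom D k p)); last by rewrite rel_atom_mean.
  apply: rel_atom_le => //.
  by rewrite /p mulrCA divff ?mulr1 ?subrr ?mulr0 // gt_eqF.
pose K := h * (D + k).+1%:R * b.
have K0 : 0 < K by apply: mulr_gt0 => //; rewrite mulr_gt0 ?ltr0n.
have Tinc (s u : R) : 0 <= s -> s <= u -> u <= 1 -> T s <= T u.
  move=> s0 su u1; rewrite -subr_ge0; apply: le_trans (HT s u 0 s0 su u1 _).
    by rewrite !mul0r.
  by move=> z /andP[z1 z2]; rewrite rel_atom_ge0 // (le_trans s0 z1) (le_trans z2).
pose S e := \sum_(0 <= v < e | near v) rel_atom D k (t v).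
have SS e : S e.+1 = S e + (if near e then rel_atom D k (t e) else 0).
  by rewrite /S big_mkcond big_nat_recr //= -big_mkcond.
(* Up to the peak the sum leaves out term [e], still to be charged to the next gap; past it the sum
   includes that term, and [2 * K] pays for the two terms around the peak. *)
have claim e : (e < n)%N ->
    if t e <= p then S e * K <= T (t e) else S e.+1 * K <= T (t e) + 2 * K.
  elim: e => [|e IH] en.
    case: ifP => _.
      rewrite /S big_nil mul0r -T0; apply: Tinc => //; apply: ltW; by case/andP: (t01 0%N).
    rewrite SS /S big_nil add0r.
    have Tt : 0 <= T (t 0%N).
      by rewrite -T0; apply: Tinc => //; apply: ltW; case/andP: (t01 0%N).
    have : (if near 0%N then rel_atom D k (t 0%N) else 0) <= 1 by case: ifP => // _; exact: g1.
    move=> /(ler_wpM2r (ltW K0)); lra.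
  have {}IH := IH (ltnW en).
  have te := tinc e en.
  have /andP[te0 te1] := t01 e; have /andP[tf0 tf1] := t01 e.+1.
  have Te := Tinc _ _ (ltW te0) te (ltW tf1).
  have step1 : (if near e then rel_atom D k (t e) else 0) <= 1.
    by case: ifP => // _; exact: g1.
  have step2 : (if near e.+1 then rel_atom D k (t e.+1) else 0) <= 1.
    by case: ifP => // _; exact: g1.
  have /(ler_wpM2r (ltW K0)) {}step1 := step1.
  have /(ler_wpM2r (ltW K0)) {}step2 := step2.
  case: ifP => tp.
    rewrite (le_trans te tp) in IH; rewrite SS mulrDl.
    case: ifP => ne; last by rewrite mul0r addr0; exact: le_trans IH Te.
    have hh := hl e en ne tp.
    have := HT (t e) (t e.+1) (rel_atom D k (t e)) (ltW te0) te (ltW tf1).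
    have -> : (forall u : R, t e <= u <= t e.+1 -> rel_atom D k (t e) <= rel_atom D k u) <-> True.
      split=> // _ u /andP[u1 u2]; apply: rel_atom_le => //.
      - by rewrite (lt_le_trans te0 u1) (le_lt_trans u2 tf1).
      - rewrite mulr_ge0 ?subr_ge0 // -ler_pdivlMl // mulrC.
        by apply: le_trans u2 tp.
    move=> /(_ I) HTe.
    have : rel_atom D k (t e) * K <= rel_atom D k (t e) * (t e.+1 - t e) * ((D + k).+1%:R * b).
      rewrite -[leRHS]mulrA; apply: ler_wpM2l; first by apply: g0; rewrite t01.
      rewrite /K -mulrA; apply: ler_wpM2r => //; apply: mulr_ge0 => //; exact: ltW.
    lra.
  rewrite SS mulrDl.
  case: ifP IH => tq IH; first by rewrite SS mulrDl; lra.
  case: ifP step2 => ne step2; last by rewrite mul0r addr0; lra.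
  have pe : p <= t e by rewrite leNgt; apply/negP => /ltW; rewrite tq.
  have hh := hr e en ne pe.
  have := HT (t e) (t e.+1) (rel_atom D k (t e.+1)) (ltW te0) te (ltW tf1).
  have -> : (forall u : R, t e <= u <= t e.+1 -> rel_atom D k (t e.+1) <= rel_atom D k u) <-> True.
    split=> // _ u /andP[u1 u2]; apply: rel_atom_le => //.
    - by rewrite (lt_le_trans te0 u1) (le_lt_trans u2 tf1).
    - rewrite mulr_le0 ?subr_le0 // -ler_pdivrMl // mulrC.
      by apply: le_trans pe u1.
  move=> /(_ I) HTe.
  have : rel_atom D k (t e.+1) * K
    <= rel_atom D k (t e.+1) * (t e.+1 - t e) * ((D + k).+1%:R * b).
    rewrite -[leRHS]mulrA; apply: ler_wpM2l; first by apply: g0; rewrite t01.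
    rewrite /K -mulrA; apply: ler_wpM2r => //; apply: mulr_ge0 => //; exact: ltW.
  lra.
rewrite -/K -/(S n).
have Kinv : 2 + K^-1 = (1 + 2 * K) / K by field; rewrite gt_eqF.
rewrite Kinv ler_pdivlMr //.
case: n {tinc hl hr} claim => [|e] claim.
  by rewrite /S big_nil mul0r; lra.
have := claim e (leqnn _).
have Te1 : T (t e) <= 1.
  have /andP[te0 te1] := t01 e.
  by rewrite -T1; apply: Tinc => //; exact: ltW.
case: ifP => _ H; last lra.
rewrite SS mulrDl.
have : (if near e then rel_atom D k (t e) else 0) <= 1 by case: ifP => // _; exact: g1.
move=> /(ler_wpM2r (ltW K0)); lra.
Qed.

(** * Vertices near and far from the target weight *)

(** The product is negative only if [x] separates the two weights; as [tangent x] increases with the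
    weight, the extreme weights 1/2 and 2 bound both factors. *)
Lemma tangent_mul_ge (R : realType) (x u v : R) :
  2^-1 <= x <= 2 -> 2^-1 <= u <= 2 -> 2^-1 <= v <= 2 ->
  - 5%:R^-1 <= tangent x u * tangent x v.
Proof.
wlog uv : u v / u <= v => [H|] hx hu hv.
  by have [uv|/ltW vu] := leP u v; [|rewrite mulrC]; exact: H.
have /andP[x1 x2] := hx; have /andP[u1 u2] := hu; have /andP[v1 v2] := hv.
have xu : 0 < 1 + x * u by rewrite addr_gt0 // mulr_gt0 //; lra.
have xv : 0 < 1 + x * v by rewrite addr_gt0 // mulr_gt0 //; lra.
have [xu'|xu'] := leP x u.
  apply: (@le_trans _ _ 0); first by rewrite oppr_le0 invr_ge0.
  by apply: mulr_ge0; apply: divr_ge0; lra.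
have [xv'|xv'] := leP v x.
  apply: (@le_trans _ _ 0); first by rewrite oppr_le0 invr_ge0.
  rewrite -mulrNN; apply: mulr_ge0; rewrite -mulNr; apply: divr_ge0; lra.
have d1 : 0 < 2 + x by lra.
have d2 : 0 < 1 + 2 * x by lra.
have a : - tangent x u <= (2 * x - 1) / (2 + x).
  rewrite -mulNr ler_pdivrMr // mulrAC ler_pdivlMr // -subr_ge0.
  rewrite (_ : _ - _ = (2 * u - 1) * (1 + x ^+ 2)); last by ring.
  by apply: mulr_ge0; [lra|rewrite addr_ge0 // sqr_ge0].
have b : tangent x v <= (2 - x) / (1 + 2 * x).
  rewrite ler_pdivrMr // mulrAC ler_pdivlMr // -subr_ge0.
  rewrite (_ : _ - _ = (2 - v) * (1 + x ^+ 2)); last by ring.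
  by apply: mulr_ge0; [lra|rewrite addr_ge0 // sqr_ge0].
rewrite lerNl -mulNr; apply: le_trans (ler_pM _ _ a b) _.
- by rewrite -mulNr; apply: divr_ge0; lra.
- by apply: divr_ge0; lra.
rewrite mulrACA -invfM ler_pdivrMr ?mulr_gt0 // -ler_pdivrMl ?invr_gt0 // invrK.
have := sqr_ge0 (x - 1); nra.
Qed.

Lemma tangent_sqr_le (R : realType) (x w : R) : 2^-1 <= x <= 2 -> 2^-1 <= w <= 2 ->
  tangent x w ^+ 2 <= 9 / 16.
Proof.
move=> /andP[x1 x2] /andP[w1 w2].
have xw : 0 < 1 + x * w by rewrite addr_gt0 // mulr_gt0 //; lra.
have a : tangent x w <= 3 / 4 by rewrite ler_pdivrMr //; nra.
have b : - (3 / 4) <= tangent x w by rewrite ler_pdivlMr //; nra.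
have : 0 <= (3 / 4 - tangent x w) * (3 / 4 + tangent x w) by apply: mulr_ge0; lra.
lra.
Qed.

Lemma rel_atom_weight (R : realType) (D k : nat) (x w : R) : (0 < D)%N -> (0 < k)%N ->
  0 < x -> 0 < w -> x ^+ 2 = D%:R / k%:R ->
  (w / x) ^+ D * ((1 + x ^+ 2) / (1 + x * w)) ^+ (D + k)
  = rel_atom D k (x * w / (1 + x * w)).
Proof.
move=> D0 k0 x0 w0 x2.
have DR : 0 < D%:R :> R by rewrite ltr0n.
have kR : 0 < k%:R :> R by rewrite ltr0n.
have xw : 0 < 1 + x * w by rewrite addr_gt0 // mulr_gt0.
have e1 : (D + k)%:R / k%:R = 1 + x ^+ 2 :> R.
  by rewrite x2 natrD; field; rewrite gt_eqF.
have e2 : (D + k)%:R / D%:R = (1 + x ^+ 2) / x ^+ 2 :> R.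
  by rewrite x2 natrD; field; rewrite !gt_eqF.
rewrite /rel_atom -[_ * (D + k)%:R / k%:R]mulrA -[_ * (D + k)%:R / D%:R]mulrA e1 e2.
rewrite exprD mulrA -exprMn; congr (_ ^+ _ * _ ^+ _); field; rewrite !gt_eqF //.
Qed.

(** With [r] the tangent, the value is [(1 + r / x)^D (1 - r x)^k]. As [D = x^2 k], the linear terms
    of the logarithms cancel, and the quadratic ones leave [k / 4 + D / 2] or [k / 2 + D / 4] times
    [r^2]. Since [D] and [k] are at least a fifth of [D + k], either is at least 3/10 of [D + k]. *)
Lemma rel_atom_le_expR (R : realType) (D k : nat) (x w : R) :
  (D + k <= 5 * D)%N -> (D + k <= 5 * k)%N -> (0 < D)%N -> (0 < k)%N ->
  2^-1 <= x <= 2 -> 2^-1 <= w <= 2 -> x ^+ 2 = D%:R / k%:R ->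
  rel_atom D k (x * w / (1 + x * w)) <= expR (- (3 / 10 * (D + k)%:R * tangent x w ^+ 2)).
Proof.
move=> hD hk D0 k0 /andP[x1 x2] /andP[w1 w2] xE.
have x0 : 0 < x by lra.
have w0 : 0 < w by lra.
have DR : 0 < D%:R :> R by rewrite ltr0n.
have kR : 0 < k%:R :> R by rewrite ltr0n.
have xw : 0 < 1 + x * w by rewrite addr_gt0 // mulr_gt0.
have hD' : (D + k)%:R <= 5 * D%:R :> R by rewrite -natrM ler_nat.
have hk' : (D + k)%:R <= 5 * k%:R :> R by rewrite -natrM ler_nat.
rewrite natrD in hD' hk' *.
have Dk : D%:R = x ^+ 2 * k%:R by rewrite xE divfK // gt_eqF.
rewrite -rel_atom_weight // exprD mulrA -exprMn.
set r := tangent x w.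
have -> : w / x * ((1 + x ^+ 2) / (1 + x * w)) = 1 + r / x.
  by rewrite /r /tangent; field; rewrite !gt_eqF.
have -> : (1 + x ^+ 2) / (1 + x * w) = 1 - r * x.
  by rewrite /r /tangent; field; rewrite !gt_eqF.
have r2 : 0 <= r ^+ 2 by exact: sqr_ge0.
have [r0|r0] := leP 0 r.
  have a1 : 0 <= r / x <= 3%:R / 2.
    rewrite divr_ge0 ?(ltW x0) //= ler_pdivrMr // ler_pdivrMr //.
    have : 0 <= (2 * x - 1) * (2 - w) by apply: mulr_ge0; lra.
    have : 0 <= (2 * x - 1) * (2 * x - 1) * w by apply: mulr_ge0; [rewrite -expr2 sqr_ge0|lra].
    nra.
  have b1 : 0 <= r * x <= 1.
    rewrite mulr_ge0 ?(ltW x0) //= mulrAC ler_pdivrMr //; nra.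
  have A := onedD_le_expR a1; have B := onedB_le_expR b1.
  have a0 : 0 <= 1 + r / x by lra.
  have b0 : 0 <= 1 - r * x by lra.
  apply: le_trans (ler_pM (exprn_ge0 _ a0) (exprn_ge0 _ b0)
    (lerXn2r D _ _ A) (lerXn2r k _ _ B)) _; rewrite ?nnegrE ?expR_ge0 //.
  rewrite -!expRM_natl -expRD ler_expR.
  have -> : D%:R * (r / x - (r / x) ^+ 2 / 4) + k%:R * (- (r * x) - (r * x) ^+ 2 / 2)
    = - ((k%:R / 4 + D%:R / 2) * r ^+ 2).
    by rewrite Dk; field; rewrite gt_eqF.
  rewrite lerN2; apply: ler_wpM2r => //; lra.
have a1 : 0 <= (- r) * x <= 3%:R / 2.
  rewrite mulr_ge0 ?(ltW x0) ?oppr_ge0 ?(ltW r0) //= -mulNr mulrAC ler_pdivrMr //.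
  nra.
have b1 : 0 <= (- r) / x <= 1.
  rewrite divr_ge0 ?(ltW x0) ?oppr_ge0 ?(ltW r0) //= ler_pdivrMr // mul1r -mulNr ler_pdivrMr //.
  nra.
have A := onedD_le_expR a1; have B := onedB_le_expR b1.
have -> : 1 - r * x = 1 + (- r) * x by ring.
have -> : 1 + r / x = 1 - (- r) / x by ring.
have a0 : 0 <= 1 + (- r) * x by lra.
have b0 : 0 <= 1 - (- r) / x by lra.
apply: le_trans (ler_pM (exprn_ge0 _ b0) (exprn_ge0 _ a0)
  (lerXn2r D _ _ B) (lerXn2r k _ _ A)) _; rewrite ?nnegrE ?expR_ge0 //.
rewrite -!expRM_natl -expRD ler_expR.
have -> : D%:R * (- (- r / x) - (- r / x) ^+ 2 / 2) + k%:R * (- r * x - (- r * x) ^+ 2 / 4)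
  = - ((k%:R / 2 + D%:R / 4) * r ^+ 2).
  by rewrite Dk; field; rewrite gt_eqF.
rewrite lerN2; apply: ler_wpM2r => //; lra.
Qed.

Lemma edge_prob_diff (R : realType) (x w w' d : R) : 0 < x -> 0 < w -> 0 < w' ->
  w' ^+ 2 / (1 + w' ^+ 2) = w ^+ 2 / (1 + w ^+ 2) + d ->
  x * w' / (1 + x * w') - x * w / (1 + x * w)
  = d * (x / (w + w')) * ((1 + w * tangent x w) * (1 + w' * tangent x w')).
Proof.
move=> x0 w0 w0' E.
have -> : d = w' ^+ 2 / (1 + w' ^+ 2) - w ^+ 2 / (1 + w ^+ 2) by rewrite E addrAC subrr add0r.
rewrite /tangent.
have a : 0 < 1 + w ^+ 2 by rewrite addr_gt0 // exprn_gt0.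
have b : 0 < 1 + w' ^+ 2 by rewrite addr_gt0 // exprn_gt0.
have c : 0 < 1 + x * w by rewrite addr_gt0 // mulr_gt0.
have e : 0 < 1 + x * w' by rewrite addr_gt0 // mulr_gt0.
have f : 0 < w + w' by rewrite addr_gt0.
by field; rewrite !gt_eqF.
Qed.

(** The difference is [d] times [x / (w + w')] times a factor close to or above 1. The quotient is
    at least 1/2 when both weights are at most [x], and only slightly less when both are at least
    [x] but close to it. Closeness is asked of the weight farther from [x]. *)
Lemma edge_prob_gap (R : realType) (x w w' d : R) :
  2^-1 <= x <= 2 -> 2^-1 <= w -> w <= w' -> w' <= 2 -> 0 <= d ->
  w' ^+ 2 / (1 + w' ^+ 2) = w ^+ 2 / (1 + w ^+ 2) + d ->
  (w' <= x /\ `|tangent x w| <= 1000^-1) \/ (x <= w /\ `|tangent x w'| <= 1000^-1) ->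
  99 / 200 * d <= x * w' / (1 + x * w') - x * w / (1 + x * w).
Proof.
move=> /andP[x1 x2] w1 ww' w2 d0 E H.
have x0 : 0 < x by lra.
have w0 : 0 < w by lra.
have w0' : 0 < w' by lra.
rewrite (edge_prob_diff x0 w0 w0' E) -[leRHS]mulrA [leLHS]mulrC; apply: ler_wpM2l => //.
clear E d d0.
have f : 0 < w + w' by lra.
have c : 0 < 1 + x * w by rewrite addr_gt0 // mulr_gt0.
have e : 0 < 1 + x * w' by rewrite addr_gt0 // mulr_gt0.
case: H => -[xw]; rewrite ler_norml => /andP[r1 r2].
  have h1 : 2^-1 <= x / (w + w') by rewrite ler_pdivlMr //; lra.
  have r3 : tangent x w <= tangent x w'.
    rewrite ler_pdivrMr // mulrAC ler_pdivlMr // -subr_ge0.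
    rewrite (_ : _ - _ = (w' - w) * (1 + x ^+ 2)); last by ring.
    by apply: mulr_ge0; [lra|rewrite addr_ge0 // sqr_ge0].
  have h2 : 499 / 500 <= 1 + w * tangent x w.
    have : 0 <= w * (tangent x w + 1000^-1) by apply: mulr_ge0; lra.
    lra.
  have h3 : 499 / 500 <= 1 + w' * tangent x w'.
    have : 0 <= w' * (tangent x w' + 1000^-1) by apply: mulr_ge0; lra.
    lra.
  have h4 : 499 / 500 * (499 / 500) <= (1 + w * tangent x w) * (1 + w' * tangent x w').
    by apply: ler_pM => //; lra.
  apply: (@le_trans _ _ (2^-1 * (499 / 500 * (499 / 500)))); first lra.
  by apply: ler_pM => //; lra.
have h1 : 99 / 200 <= x / (w + w').
  rewrite ler_pdivlMr //.
  have : w' - x <= 1000^-1 * (1 + x * w') by rewrite -ler_pdivrMr.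
  have : x * w' <= 2 * 2 by apply: ler_pM; lra.
  lra.
have h2 : 1 <= 1 + w * tangent x w.
  by rewrite lerDl mulr_ge0 ?(ltW w0) // divr_ge0 ?subr_ge0 // ltW.
have h3 : 1 <= 1 + w' * tangent x w'.
  by rewrite lerDl mulr_ge0 ?(ltW w0') // divr_ge0 ?subr_ge0 ?(le_trans xw) // ltW.
have h4 : 1 * 1 <= (1 + w * tangent x w) * (1 + w' * tangent x w') by apply: ler_pM.
by rewrite -[leLHS]mulr1; apply: ler_pM => //; lra.
Qed.

(** The threshold keeps the quartic part of the exponent in [tilted_weight] at most 1/100. *)
Definition near_target (R : realType) (m : nat) (x : R) (w : nat -> R) (v : nat) : bool :=
  m%:R * tangent x (w v) ^+ 4 <= 50^-1.

Lemma near_target_small (R : realType) (m : nat) (x : R) (w : nat -> R) (v : nat) :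
  10 ^+ 14 <= m%:R :> R -> near_target m x w v -> `|tangent x (w v)| <= 1000^-1.
Proof.
move=> hm; rewrite /near_target; move: (tangent _ _) => r h.
have r4 : 0 <= r ^+ 4 by rewrite (exprM _ 2 2) sqr_ge0.
have h1 : r ^+ 4 <= 1000^-1 ^+ 4.
  have := ler_wpM2r r4 hm => h2.
  have : 10 ^+ 14 * r ^+ 4 <= 50^-1 by apply: le_trans h2 h.
  lra.
have h2 : `|r| ^+ 4 <= 1000^-1 ^+ 4 by rewrite -normrX ger0_norm.
by move: h2; rewrite ler_pXn2r ?nnegrE ?normr_ge0 ?invr_ge0 //.
Qed.

Lemma near_factor (R : realType) (m : nat) (x : R) (w : nat -> R) (v : nat) :
  10 ^+ 14 <= m%:R :> R -> near_target m x w v ->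
  expR (tangent x (w v) ^+ 2 / 2 + m%:R * tangent x (w v) ^+ 4 / 2) <= 1011 / 1000.
Proof.
move=> hm hn; have := near_target_small hm hn; move: hn; rewrite /near_target.
move: (tangent _ _) => r h; rewrite ler_norml => /andP[r1 r2].
have r3 : 0 <= (1000^-1 - r) * (1000^-1 + r) by apply: mulr_ge0; lra.
set y := _ + _; have y1 : y <= 101 / 10000 by rewrite /y; lra.
have := expR_ge1Dx (- y); rewrite expRN => hy.
have e0 := expR_gt0 y.
rewrite -[leLHS]invrK -[leRHS]invrK lef_pV2 ?posrE ?invr_gt0 //; lra.
Qed.

(** As [r^2 <= 9/16], the quartic correction is at most [9/32 m r^2], and the decay at rate 3/10
    leaves more than [y = m r^2 / 100]. Far from the target [m r^4 > 1/50], so [expR y >= y^4 / 24]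
    is of order [m^2]; summed over the vertices this costs only a constant. *)
Lemma far_factor (R : realType) (N : nat) (r : R) :
  10 ^+ 14 <= N.+1%:R :> R -> r ^+ 2 <= 9 / 16 -> 50^-1 < N.+1%:R * r ^+ 4 ->
  expR (- (3 / 10 * N%:R * r ^+ 2)) * expR (r ^+ 2 / 2 + N.+1%:R * r ^+ 4 / 2)
  <= 6 * 10 ^+ 12 / N.+1%:R ^+ 2.
Proof.
move=> hm r2 hr; set m := N.+1%:R in hm hr *.
have mN : N%:R = m - 1 by rewrite /m -natr1 addrK.
have r0 := sqr_ge0 r.
have r4 : r ^+ 4 = r ^+ 2 * r ^+ 2 by rewrite -exprD.
have r4le : r ^+ 4 <= 9 / 16 * r ^+ 2 by rewrite r4 ler_wpM2r.
have m0 : 0 < m by rewrite /m ltr0n.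
have mr : m * r ^+ 4 <= m * (9 / 16 * r ^+ 2) by rewrite ler_pM2l.
have rm : 0 <= (m - 10 ^+ 14) * r ^+ 2 by apply: mulr_ge0; lra.
rewrite -expRD mN; set y := m * r ^+ 2 / 100.
apply: (@le_trans _ _ (expR (- y))); first by rewrite ler_expR /y; lra.
have y0 : 0 <= y by rewrite /y divr_ge0 // mulr_ge0 // ltW.
rewrite expRN -[leRHS]invrK lef_pV2 ?posrE ?expR_gt0 //; last first.
  by rewrite invr_gt0 divr_gt0 ?mulr_gt0 ?exprn_gt0.
rewrite invf_div; apply: le_trans (_ : y ^+ 4 / 24 <= _); last first.
  have := expR_ge1Dxn 3 y0; rewrite (_ : 4`!%:R = 24 :> R) //; lra.
rewrite ler_pdivrMr ?mulr_gt0 ?exprn_gt0 //.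
have h : (50^-1) ^+ 2 <= (m * r ^+ 4) ^+ 2.
  by apply: lerXn2r; rewrite ?nnegrE; lra.
have -> : y ^+ 4 / 24 * (6 * 10 ^+ 12) = m ^+ 2 * (m * r ^+ 4) ^+ 2 * 2500.
  by rewrite /y; field.
have m2 : 0 <= m ^+ 2 by exact: sqr_ge0.
have := ler_wpM2l m2 h; lra.
Qed.

Lemma edge_prob_le (R : realType) (x u v : R) : 0 < x -> 0 < u -> 0 < v ->
  (x * u / (1 + x * u) <= x * v / (1 + x * v)) = (u <= v).
Proof.
move=> x0 u0 v0.
have a : 0 < 1 + x * u by rewrite addr_gt0 // mulr_gt0.
have b : 0 < 1 + x * v by rewrite addr_gt0 // mulr_gt0.
rewrite ler_pdivrMr // mulrAC ler_pdivlMr // !mulrDr !mulr1 mulrACA [x * v * (x * u)]mulrACA.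
by rewrite [v * u]mulrC lerD2r ler_pM2l.
Qed.

Lemma tilted_weight_le (R : realType) (D k : nat) (x : R) (w : nat -> R) (v : nat) :
  10 ^+ 14 <= (D + k).+1%:R :> R ->
  (D + k <= 5 * D)%N -> (D + k <= 5 * k)%N -> (0 < D)%N -> (0 < k)%N ->
  2^-1 <= x <= 2 -> 2^-1 <= w v <= 2 -> x ^+ 2 = D%:R / k%:R ->
  tilted_weight w x D (D + k) v
  <= (if near_target (D + k).+1 x w v then 1011 / 1000 * rel_atom D k (x * w v / (1 + x * w v))
      else 0) + 6 * 10 ^+ 12 / (D + k).+1%:R ^+ 2.
Proof.
move=> hm hD hk D0 k0 hx hw xE.
have [x0 w0] : 0 < x /\ 0 < w v by move: hx hw => /andP[? _] /andP[? _]; split; lra.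
have far0 : 0 <= 6 * 10 ^+ 12 / (D + k).+1%:R ^+ 2 :> R.
  by rewrite divr_ge0 ?mulr_ge0 ?exprn_ge0.
rewrite /tilted_weight rel_atom_weight //.
have g0 : 0 <= rel_atom D k (x * w v / (1 + x * w v)).
  have a : 0 < x * w v by rewrite mulr_gt0.
  apply: rel_atom_ge0; rewrite divr_ge0 ?addr_ge0 ?(ltW a) //=.
  by rewrite ler_pdivrMr ?mul1r ?lerDr // addr_gt0.
case: ifP => hn.
  rewrite mulrC -[leLHS]addr0; apply: lerD => //; apply: ler_wpM2r => //.
  exact: near_factor.
rewrite add0r.
have hr : 50^-1 < (D + k).+1%:R * tangent x (w v) ^+ 4.
  by rewrite ltNge; move/negbT: hn.
apply: le_trans (far_factor hm (tangent_sqr_le hx hw) hr).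
by apply: ler_wpM2r; [exact: expR_ge0|exact: rel_atom_le_expR].
Qed.

Lemma sum_tilted_le (R : realType) (D k n : nat) (x d : R) (w : nat -> R) :
  10 ^+ 14 <= (D + k).+1%:R :> R ->
  (D + k <= 5 * D)%N -> (D + k <= 5 * k)%N -> (0 < D)%N -> (0 < k)%N ->
  2^-1 <= x <= 2 -> (forall v, 2^-1 <= w v <= 2) -> x ^+ 2 = D%:R / k%:R ->
  (forall v, (v.+1 < n)%N -> w v <= w v.+1) ->
  (forall v, (v.+1 < n)%N ->
     w v.+1 ^+ 2 / (1 + w v.+1 ^+ 2) = w v ^+ 2 / (1 + w v ^+ 2) + d) ->
  0 < d -> 163 * n%:R <= 9 * (D + k).+1%:R ^+ 2 :> R ->
  9454 * d^-1 <= 900 * (D + k).+1%:R ^+ 2 ->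
  \sum_(0 <= v < n) tilted_weight w x D (D + k) v
  <= (D + k).+1%:R / (5 * atom (D%:R / (D + k)%:R) (D + k) D).
Proof.
move=> hm hD hk D0 k0 hx hw xE winc wE d0 hn hd.
have x0 : 0 < x by move: hx => /andP[? _]; lra.
have w0 v : 0 < w v by have /andP[? _] := hw v; lra.
have DR : 0 < D%:R :> R by rewrite ltr0n.
have kR : 0 < k%:R :> R by rewrite ltr0n.
have pE : D%:R / (D + k)%:R = x * x / (1 + x * x).
  by rewrite -expr2 xE natrD; field; rewrite !gt_eqF // addr_gt0.
have p01 : 0 <= (D%:R / (D + k)%:R : R) <= 1.
  by rewrite divr_ge0 //= ler_pdivrMr ?mul1r ?ler_nat ?leq_addr // ltr0n addn_gt0 D0.
set m := (D + k).+1%:R in hm hn hd *; set b := atom _ _ _.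
have b1 : b <= 1 by exact: atom_le1.
have m0 : 0 < m by rewrite /m ltr0n.
have b0 : 0 < b.
  have := @atom_mean_ge R D (D + k); rewrite -/m -/b => h.
  have /h {}h : (0 < D < D + k)%N by rewrite D0 -[X in (X < _)%N]addn0 ltn_add2l.
  by rewrite -(pmulr_rgt0 _ m0); apply: lt_le_trans h.
pose t v := x * w v / (1 + x * w v).
have t01 v : 0 < t v < 1.
  have a : 0 < x * w v by rewrite mulr_gt0.
  by rewrite divr_gt0 ?addr_gt0 //= ltr_pdivrMr ?mul1r ?ltrDr // addr_gt0.
pose near := near_target (D + k).+1 x w.
have h0 : 0 < 99 / 200 * d by rewrite mulr_gt0 // divr_gt0.
have hl v : (v.+1 < n)%N -> near v -> t v.+1 <= D%:R / (D + k)%:R ->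
    99 / 200 * d <= t v.+1 - t v.
  move=> vn nv; rewrite pE edge_prob_le // => wx.
  have /andP[wl _] := hw v; have /andP[_ wu] := hw v.+1.
  apply: (edge_prob_gap hx wl (winc v vn) wu (ltW d0) (wE v vn)); left; split=> //.
  exact: near_target_small hm nv.
have hr v : (v.+1 < n)%N -> near v.+1 -> D%:R / (D + k)%:R <= t v ->
    99 / 200 * d <= t v.+1 - t v.
  move=> vn nv; rewrite pE edge_prob_le // => wx.
  have /andP[wl _] := hw v; have /andP[_ wu] := hw v.+1.
  apply: (edge_prob_gap hx wl (winc v vn) wu (ltW d0) (wE v vn)); right; split=> //.
  exact: near_target_small hm nv.
have tinc v : (v.+1 < n)%N -> t v <= t v.+1 by move=> vn; rewrite edge_prob_le // winc.
have near_sum := spaced_sum_le D0 k0 h0 t01 tinc hl hr.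
rewrite -/b -/m in near_sum.
(* The main term is about [0.1945 m / b], below the target [m / (5 b)]. The remaining constants,
   about [3.4 * 10^11], fit into the slack because [m >= 10^14] and [b <= 1]. *)
apply: (@le_trans _ _ (1011 / 1000 * (2 + (99 / 200 * d * m * b)^-1)
    + n%:R * (6 * 10 ^+ 12 / m ^+ 2))).
  apply: (@le_trans _ _ (\sum_(0 <= v < n)
    ((if near v then 1011 / 1000 * rel_atom D k (t v) else 0) + 6 * 10 ^+ 12 / m ^+ 2))).
    by apply: ler_sum => v _; apply: tilted_weight_le.
  rewrite big_split /= -big_mkcond -mulr_sumr sumr_const_nat subn0.
  rewrite -[X in _ + X <= _]mulr_natl; apply: lerD => //.
  by apply: ler_wpM2l => //; rewrite divr_ge0.
have hinv : (99 / 200 * d * m * b)^-1 <= 20000 * 9 / (99 * 9454) * (m / b).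
  have gen (d' m' b' : R) : 0 < d' -> 0 < m' -> 0 < b' -> 9454 * d'^-1 <= 900 * m' ^+ 2 ->
      (99 / 200 * d' * m' * b')^-1 <= 20000 * 9 / (99 * 9454) * (m' / b').
    move=> d'0 m'0 b'0 h.
    have -> : (99 / 200 * d' * m' * b')^-1 = 200 / 99 * d'^-1 / (m' * b').
      by field; rewrite !gt_eqF.
    rewrite ler_pdivrMr ?mulr_gt0 //.
    have -> : 20000 * 9 / (99 * 9454) * (m' / b') * (m' * b') = 20000 * 9 / (99 * 9454) * m' ^+ 2.
      by field; rewrite gt_eqF.
    by clear -h; lra.
  exact: gen.
have mb : m <= m / b by rewrite ler_pdivlMr // ler_piMr // ltW.
have hfar : n%:R * (6 * 10 ^+ 12 / m ^+ 2) <= 6 * 10 ^+ 12 * 9 / 163.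
  by rewrite mulrA ler_pdivrMr ?exprn_gt0 //; clear -hn; lra.
have -> : m / (5 * b) = m / b / 5 by rewrite invfM mulrCA mulrC.
move: hinv hfar mb hm; move: (_^-1) (n%:R * _) (m / b) => i f z.
clear; move=> *; lra.
Qed.

(** * Numerical conclusion *)

Lemma exp_decay (R : realType) (c : R) (j : nat) : 0 <= c ->
  exists m0 : nat, forall m : nat, (m0 <= m)%N -> c * m%:R ^+ j * (81 / 100) ^+ m <= 1.
Proof.
move=> c0; set C : R := c * (j.+1`!%:R * (100 / 19) ^+ j.+1).
have C0 : 0 <= C.
  by apply: mulr_ge0 => //; apply: mulr_ge0 => //; apply: exprn_ge0; apply: divr_ge0.
exists (Num.bound C).+1 => m hm.
have mC : C <= m%:R.
  by apply: le_trans (ltW (archi_boundP C0)) _; rewrite ler_nat ltnW.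
have m0 : 0 < m%:R :> R by rewrite ltr0n; apply: leq_trans hm.
set y : R := 19 / 100 * m%:R.
have y0 : 0 < y by apply: mulr_gt0 => //; apply: divr_gt0.
have h1 : (81 / 100) ^+ m <= expR (- y).
  have -> : - y = m%:R * (- (19 / 100)) by rewrite /y; ring.
  rewrite expRM_natl; apply: lerXn2r; rewrite ?nnegrE ?expR_ge0 ?divr_ge0 //.
  by have := expR_ge1Dx (- (19 / 100) : R); lra.
have h2 : expR (- y) <= j.+1`!%:R / y ^+ j.+1.
  rewrite expRN -[leRHS]invrK lef_pV2 ?posrE ?expR_gt0 //; last first.
    by rewrite invr_gt0 divr_gt0 ?exprn_gt0 ?ltr0n ?fact_gt0.
  rewrite invf_div; apply: le_trans (expR_ge1Dxn j (ltW y0)).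
  by rewrite lerDr.
apply: (@le_trans _ _ (c * m%:R ^+ j * (j.+1`!%:R / y ^+ j.+1))).
  apply: ler_wpM2l; first by rewrite mulr_ge0 // exprn_ge0.
  exact: le_trans h1 h2.
have -> : c * m%:R ^+ j * (j.+1`!%:R / y ^+ j.+1) = C / m%:R.
  rewrite /C /y exprMn [m%:R ^+ j.+1]exprS -[100 / 19]invf_div exprVn.
  have q0 : (19 / 100) ^+ j.+1 != 0 :> R.
    by rewrite expf_neq0 // lt0r_neq0 // divr_gt0.
  have mj : m%:R ^+ j != 0 :> R by rewrite expf_neq0 // gt_eqF.
  have gen (e z f q u : R) : z != 0 -> q != 0 -> u != 0 ->
      e * u * (f / (q * (z * u))) = e * (f * q^-1) / z.
    by move=> z0 q1 u0; field; rewrite z0 q1 u0.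
  by apply: gen => //; rewrite gt_eqF.
by rewrite ler_pdivrMr // mul1r.
Qed.

Lemma binomial_atom (R : realType) (D k j i : nat) : (0 < D)%N -> (0 < k)%N ->
  'C(j, i)%:R * (D%:R / k%:R) ^+ i
  = atom (D%:R / (D + k)%:R) j i * (1 + D%:R / k%:R) ^+ j :> R.
Proof.
move=> D0 k0; have [ij|ij] := leqP i j; last by rewrite /atom bin_small // !mul0r.
have DR : D%:R != 0 :> R by rewrite pnatr_eq0 -lt0n.
have kR : k%:R != 0 :> R by rewrite pnatr_eq0 -lt0n.
have NR : D%:R + k%:R != 0 :> R by rewrite -natrD pnatr_eq0 -lt0n addn_gt0 D0.
rewrite /atom natrD -[in X in _ * (1 + _) ^+ X](subnKC ij) exprD.
have -> : 'C(j, i)%:R * (D%:R / (D%:R + k%:R)) ^+ i * (1 - D%:R / (D%:R + k%:R)) ^+ (j - i)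
    * ((1 + D%:R / k%:R) ^+ i * (1 + D%:R / k%:R) ^+ (j - i))
  = 'C(j, i)%:R * (D%:R / (D%:R + k%:R) * (1 + D%:R / k%:R)) ^+ i
    * ((1 - D%:R / (D%:R + k%:R)) * (1 + D%:R / k%:R)) ^+ (j - i) :> R.
  by rewrite !exprMn; ring.
have -> : (1 - D%:R / (D%:R + k%:R)) * (1 + D%:R / k%:R) = 1 :> R.
  by field; rewrite kR NR.
have -> : D%:R / (D%:R + k%:R) * (1 + D%:R / k%:R) = D%:R / k%:R :> R.
  by field; rewrite kR NR.
by rewrite expr1n mulr1.
Qed.

(** The powers of the central atom cancel. After squaring, the product of atoms leaves [expR N], the
    quotient of [m^m] by [m!] at most [expR m] squared, and the factor 1/5 gives [25^-m]; the base
    is [e^3 / 25 <= 81/100]. *)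
Lemma union_term_le (R : realType) (D N : nat) (H : R) :
  (10 <= N)%N -> (N <= 5 * D)%N -> (5 * D <= 4 * N)%N -> 0 <= H ->
  H <= N.+1%:R / (5 * atom (D%:R / N%:R) N D) ->
  ((\prod_(0 <= j < N.+1) atom (D%:R / N%:R : R) j (mode D N j)) * H ^+ N.+1 / N.+1`!%:R) ^+ 2
  <= N.+1%:R ^+ 42 * (81 / 100) ^+ N.+1.
Proof.
move=> N10 h5 h4 H0 hH.
have A := prod_mode_sqr_le R N10 h5 h4.
have DN : (0 < D < N)%N by lia.
have b0 : 0 < atom (D%:R / N%:R : R) N D.
  have h := atom_mean_ge R DN.
  by rewrite -(@pmulr_rgt0 _ N.+1%:R) ?ltr0n //; apply: lt_le_trans h.
set m := N.+1 in A hH *; set b := atom _ _ _ in A hH b0.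
have m0 : 0 < m%:R :> R by rewrite ltr0n.
have f0 : 0 < m`!%:R :> R by rewrite ltr0n fact_gt0.
rewrite [leLHS]exprMn [X in X * _]exprMn.
have hX : (H ^+ m) ^+ 2 <= ((m%:R / (5 * b)) ^+ m) ^+ 2.
  by rewrite -!exprM; apply: lerXn2r; rewrite ?nnegrE // (le_trans H0 hH).
have F := exprn_fact_le_expR R m.
have F0 : 0 <= m%:R ^+ m / m`!%:R :> R by rewrite divr_ge0 ?exprn_ge0.
have F2 : (m%:R ^+ m / m`!%:R) ^+ 2 <= expR m%:R ^+ 2 :> R.
  by apply: lerXn2r; rewrite ?nnegrE ?expR_ge0.
apply: (@le_trans _ _ (m%:R ^+ 42 * (b ^+ 2) ^+ m * expR N%:R
    * ((m%:R / (5 * b)) ^+ m) ^+ 2 * (m`!%:R)^-1 ^+ 2)).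
  apply: ler_wpM2r; first exact: sqr_ge0.
  by apply: ler_pM => //; exact: sqr_ge0.
have -> : m%:R ^+ 42 * (b ^+ 2) ^+ m * expR N%:R * ((m%:R / (5 * b)) ^+ m) ^+ 2 * (m`!%:R)^-1 ^+ 2
  = m%:R ^+ 42 * (expR N%:R * (m%:R ^+ m / m`!%:R) ^+ 2 * 25^-1 ^+ m) :> R.
  rewrite [in RHS]exprMn.
  have -> : ((m%:R / (5 * b)) ^+ m) ^+ 2 = (m%:R ^+ m) ^+ 2 * ((b ^+ 2)^-1 ^+ m * 25^-1 ^+ m).
    rewrite [((m%:R / _) ^+ m) ^+ 2]exprAC [(m%:R ^+ m) ^+ 2]exprAC -!exprMn; congr (_ ^+ _).
    by field; rewrite gt_eqF.
  have -> : (b ^+ 2)^-1 ^+ m = ((b ^+ 2) ^+ m)^-1 by rewrite exprVn.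
  have B0 : (b ^+ 2) ^+ m != 0 by rewrite !expf_neq0 // gt_eqF.
  move: ((b ^+ 2) ^+ m) B0 => B B0; move: (_ ^+ 42) (25^-1 ^+ m) (expR _) (_^-1 ^+ 2) (_ ^+ 2).
  by move=> u v e f g; field.
apply: ler_wpM2l; first by rewrite exprn_ge0 // ltW.
have e3 : expR m%:R ^+ 3 <= (81 / 4) ^+ m :> R.
  have -> : expR m%:R ^+ 3 = expR 3 ^+ m :> R by rewrite -!expRM_natl mulrC.
  by apply: lerXn2r; rewrite ?nnegrE ?expR_ge0 ?divr_ge0 ?expR3_le.
have eN : expR N%:R <= expR m%:R :> R by rewrite ler_expR ler_nat.
apply: (@le_trans _ _ (expR m%:R ^+ 3 * 25^-1 ^+ m)).
  apply: ler_wpM2r; first by rewrite exprn_ge0 // invr_ge0.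
  by rewrite exprS; apply: ler_pM => //; [exact: expR_ge0|exact: sqr_ge0].
have -> : (81 / 100 : R) = 81 / 4 * 25^-1 by field.
by rewrite [leRHS]exprMn; apply: ler_wpM2r => //; rewrite exprn_ge0 // invr_ge0.
Qed.

(** * The grid of weights and the choice of parameters *)

(** Equally spaced values of [w^2 / (1 + w^2)]. Since 9454 = 163 * 58, at most [9 k^2 / 163] steps
    have total length at most 58/100, so the grid stays in [[0.21, 0.79]] and the weights in
    [[1/2, 2]]. The minimum extends these bounds to all indices. *)
Definition grid_prob (R : realType) (k n v : nat) : R :=
  21 / 100 + 9454 / (900 * k%:R ^+ 2) * (minn v n)%:R.

Definition grid_weight (R : realType) (k n v : nat) : R :=
  Num.sqrt (grid_prob R k n v / (1 - grid_prob R k n v)).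

Lemma grid_prob_bounds (R : realType) (k n v : nat) : (0 < k)%N ->
  (163 * n < 9 * k ^ 2)%N -> 21 / 100 <= grid_prob R k n v <= 79 / 100.
Proof.
move=> k0 kn; have kR : 0 < k%:R ^+ 2 :> R by rewrite exprn_gt0 // ltr0n.
have d0 : 0 <= 9454 / (900 * k%:R ^+ 2) :> R.
  by rewrite divr_ge0 // mulr_ge0 // ltW.
have h : (minn v n)%:R <= n%:R :> R by rewrite ler_nat geq_minr.
have hn : 163 * n%:R <= 9 * k%:R ^+ 2 :> R by rewrite -natrX -!natrM ler_nat ltnW.
have h1 : 9454 / (900 * k%:R ^+ 2) * (minn v n)%:R <= 58 / 100 :> R.
  apply: le_trans (ler_wpM2l d0 h) _.
  by rewrite mulrAC ler_pdivrMr; [lra|rewrite mulr_gt0].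
have h2 : 0 <= 9454 / (900 * k%:R ^+ 2) * (minn v n)%:R :> R by rewrite mulr_ge0.
by rewrite /grid_prob; clear -h1 h2; lra.
Qed.

Lemma grid_weight_sqr (R : realType) (k n v : nat) : (0 < k)%N ->
  (163 * n < 9 * k ^ 2)%N ->
  grid_weight R k n v ^+ 2 = grid_prob R k n v / (1 - grid_prob R k n v).
Proof.
move=> k0 kn; have /andP[p1 p2] := grid_prob_bounds R v k0 kn.
by rewrite /grid_weight sqr_sqrtr // divr_ge0 //; lra.
Qed.

Lemma grid_weight_bounds (R : realType) (k n v : nat) : (0 < k)%N ->
  (163 * n < 9 * k ^ 2)%N -> 2^-1 <= grid_weight R k n v <= 2.
Proof.
move=> k0 kn; have w2 := grid_weight_sqr R v k0 kn.
have /andP[p1 p2] := grid_prob_bounds R v k0 kn.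
have w0 : 0 <= grid_weight R k n v by exact: sqrtr_ge0.
have q0 : 0 < 1 - grid_prob R k n v by lra.
apply/andP; split.
  rewrite -(@ler_pXn2r _ 2) ?nnegrE ?invr_ge0 // w2 ler_pdivlMr //; lra.
by rewrite -(@ler_pXn2r _ 2) ?nnegrE // w2 ler_pdivrMr //; lra.
Qed.

Lemma grid_weight_prob (R : realType) (k n v : nat) : (0 < k)%N ->
  (163 * n < 9 * k ^ 2)%N ->
  grid_weight R k n v ^+ 2 / (1 + grid_weight R k n v ^+ 2) = grid_prob R k n v.
Proof.
move=> k0 kn; have /andP[p1 p2] := grid_prob_bounds R v k0 kn.
rewrite grid_weight_sqr //; field.
by apply/andP; split; rewrite ?lt0r_neq0 //; lra.
Qed.

Lemma clamp_degree (N d : nat) : (1000 <= N)%N -> (d <= N)%N ->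
  exists D, [/\ (N <= 5 * D)%N, (5 * D <= 4 * N)%N,
     (d <= D)%N \/ (79 * N <= 100 * D)%N & (D <= d)%N \/ (100 * D <= 21 * N)%N].
Proof.
move=> hN dN.
have [h1|h1] := leqP N (5 * d); last first.
  exists ((N + 4) %/ 5)%N; split; lia.
have [h2|h2] := leqP (5 * d) (4 * N); first by exists d; split; lia.
exists ((4 * N) %/ 5)%N; split; lia.
Qed.

(** Only [(w v / x) ^+ d] depends on the degree, and its base lies on the side of 1 that makes
    moving to [D] harmless. *)
Lemma tilted_weight_clamp (R : realType) (w : nat -> R) (x : R) (d D N v : nat) :
  0 < x -> 0 < w v -> (d <= D)%N \/ w v <= x -> (D <= d)%N \/ x <= w v ->
  tilted_weight w x d N v <= tilted_weight w x D N v.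
Proof.
move=> x0 w0 h1 h2; rewrite /tilted_weight -!mulrA.
apply: ler_wpM2r.
  rewrite mulr_ge0 ?expR_ge0 // exprn_ge0 // divr_ge0 ?addr_ge0 ?mulr_ge0 ?exprn_ge0 //;
  exact: ltW.
have wx0 : 0 <= w v / x by rewrite divr_ge0 // ltW.
have [dD|dD|<-//] := ltngtP d D.
  case: h2 => [|xw]; first by rewrite leqNgt dD.
  by apply: ler_weXn2l; rewrite ?ler_pdivlMr ?mul1r // ltnW.
case: h1 => [|wx]; first by rewrite leqNgt dD.
by apply: ler_wiXn2l; rewrite ?ler_pdivrMr ?mul1r // ltnW.
Qed.

Lemma grid_weight_step (R : realType) (k n v : nat) : (0 < k)%N ->
  (163 * n < 9 * k ^ 2)%N -> (v.+1 < n)%N ->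
  grid_prob R k n v.+1 = grid_prob R k n v + 9454 / (900 * k%:R ^+ 2)
  /\ grid_weight R k n v <= grid_weight R k n v.+1.
Proof.
move=> k0 kn vn.
have pE : grid_prob R k n v.+1 = grid_prob R k n v + 9454 / (900 * k%:R ^+ 2).
  rewrite /grid_prob (minn_idPl (ltnW vn)) (minn_idPl (ltnW (ltnW vn))).
  by rewrite -[v.+1%:R]natr1 mulrDr mulr1 addrA.
split=> //; apply: ler_wsqrtr.
have /andP[p1 p2] := grid_prob_bounds R v k0 kn.
have /andP[r1 r2] := grid_prob_bounds R v.+1 k0 kn.
have d0 : 0 <= 9454 / (900 * k%:R ^+ 2) :> R.
  by rewrite divr_ge0 // mulr_ge0 // exprn_ge0.
move: r1 r2; rewrite pE; move: (grid_prob _ _ _ _) (9454 / _) p1 p2 d0 => p d p1 p2 d0 r1 r2.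
by rewrite ler_pdivrMr; [rewrite mulrAC ler_pdivlMr; nra|lra].
Qed.

Lemma union_term_grid (R : realType) (k n N d : nat) :
  10 ^+ 14 <= k%:R :> R -> (1000 < k)%N -> (163 * n < 9 * k ^ 2)%N ->
  (k <= N.+1)%N -> (d <= N)%N ->
  4 * N.+1%:R ^+ 50 * (81 / 100) ^+ N.+1 <= 1 :> R ->
  exists (x : R) (a : nat -> R),
  [/\ 0 < x,
      forall u v, - 5%:R^-1 <= tangent x (grid_weight R k n u) * tangent x (grid_weight R k n v),
      forall j, 0 <= a j,
      forall j i, 'C(j, i)%:R * x ^+ 2 ^+ i <= a j * (1 + x ^+ 2) ^+ j
    & (\prod_(0 <= j < N.+1) a j)
      * (\sum_(0 <= v < n) tilted_weight (grid_weight R k n) x d N v) ^+ N.+1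
      / N.+1`!%:R <= (n.+1%:R ^+ 2 + 1)^-1].
Proof.
move=> hk k1000 kn kN dN hm; set w := grid_weight R k n.
have k0 : (0 < k)%N by apply: leq_trans k1000.
have hw v : 2^-1 <= w v <= 2 by exact: grid_weight_bounds.
have w0 v : 0 < w v by have /andP[h _] := hw v; apply: lt_le_trans h; rewrite invr_gt0.
have N1000 : (1000 <= N)%N by rewrite -ltnS (leq_trans k1000).
have [D [h5 h4 hlo hhi]] := clamp_degree N1000 dN.
have D0 : (0 < D)%N by lia.
have [q NE] : exists q, N = (D + q)%N by exists (N - D)%N; lia.
have q0 : (0 < q)%N by lia.
have hq : (D + q <= 5 * q)%N by lia.
have hD : (D + q <= 5 * D)%N by lia.
have mR : 10 ^+ 14 <= N.+1%:R :> R by apply: (le_trans hk); rewrite ler_nat.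
pose x : R := Num.sqrt (D%:R / q%:R).
have DR : 0 < D%:R :> R by rewrite ltr0n.
have qR : 0 < q%:R :> R by rewrite ltr0n.
have xE : x ^+ 2 = D%:R / q%:R by rewrite sqr_sqrtr // divr_ge0.
have x0 : 0 < x by rewrite sqrtr_gt0 divr_gt0.
have hx : 2^-1 <= x <= 2.
  apply/andP; split; rewrite -(@ler_pXn2r _ 2) ?nnegrE ?invr_ge0 ?(ltW x0) // xE.
    have h : q%:R <= 4 * D%:R :> R by rewrite -natrM ler_nat; lia.
    by rewrite ler_pdivlMr //; clear -h; lra.
  have h : D%:R <= 4 * q%:R :> R by rewrite -natrM ler_nat; lia.
  by rewrite ler_pdivrMr //; clear -h; lra.
(* [x ^+ 2] is the odds of success probability [D / N], whose largest atoms are those at the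
   modes. *)
exists x, (fun j => atom (D%:R / N%:R) j (mode D N j)).
have p01 : 0 <= (D%:R / N%:R : R) <= 1.
  by rewrite NE divr_ge0 //= ler_pdivrMr ?mul1r ?ler_nat ?leq_addr // ltr0n addn_gt0 D0.
have DN : (0 < D < N)%N by rewrite D0 NE -[X in (X < _)%N]addn0 ltn_add2l.
split=> // [u v|j|j i|].
- exact: tangent_mul_ge.
- exact: atom_ge0.
- rewrite xE binomial_atom // -NE; apply: ler_wpM2r.
    by rewrite exprn_ge0 // addr_ge0 // divr_ge0.
  exact: mode_max.
have [xlo xhi] : (forall v, (d <= D)%N \/ w v <= x) /\ (forall v, (D <= d)%N \/ x <= w v).
  have bounds v := grid_prob_bounds R v k0 kn.
  split=> v.
    case: hlo => h; [by left|right]; apply: ler_wsqrtr.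
    have /andP[b1 b2] := bounds v.
    have h' : 79 * q%:R <= 21 * D%:R :> R by rewrite -!natrM ler_nat; clear -h NE; lia.
    move: (grid_prob _ _ _ _) b1 b2 => p b1 b2.
    rewrite ler_pdivlMr // mulrAC ler_pdivrMr; last lra.
    clear -h' b1 b2 DR qR; nra.
  case: hhi => h; [by left|right]; apply: ler_wsqrtr.
  have /andP[b1 b2] := bounds v.
  have h' : 79 * D%:R <= 21 * q%:R :> R by rewrite -!natrM ler_nat; clear -h NE; lia.
  move: (grid_prob _ _ _ _) b1 b2 => p b1 b2.
  rewrite ler_pdivrMr // mulrAC ler_pdivlMr; last lra.
  clear -h' b1 b2 DR qR; nra.
have kR : 0 < k%:R :> R by rewrite ltr0n.
have kN2 : k%:R ^+ 2 <= N.+1%:R ^+ 2 :> R by apply: lerXn2r; rewrite ?nnegrE ?ler_nat.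
have nR : 163 * n%:R <= 9 * k%:R ^+ 2 :> R by rewrite -natrX -!natrM ler_nat ltnW.
have sumD : \sum_(0 <= v < n) tilted_weight w x D N v
    <= N.+1%:R / (5 * atom (D%:R / N%:R) N D).
  rewrite NE in mR kN2 *; apply: (@sum_tilted_le _ _ _ _ _ (9454 / (900 * k%:R ^+ 2))) => //.
  - by move=> v vn; have [] := grid_weight_step R k0 kn vn.
  - move=> v vn; rewrite !grid_weight_prob //.
    by have [-> _] := grid_weight_step R k0 kn vn.
  - by rewrite divr_gt0 // mulr_gt0 // exprn_gt0.
  - by apply: (le_trans nR); rewrite ler_pM2l.
  - rewrite invf_div mulrCA divff; last by rewrite pnatr_eq0.
    by rewrite mulr1 ler_pM2l.
have tw0 e v : 0 <= tilted_weight w x e N v.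
  rewrite !mulr_ge0 ?expR_ge0 ?exprn_ge0 ?divr_ge0 ?addr_ge0 ?mulr_ge0 ?exprn_ge0 //;
    exact: ltW.
have sumd : \sum_(0 <= v < n) tilted_weight w x d N v
    <= N.+1%:R / (5 * atom (D%:R / N%:R) N D).
  apply: le_trans sumD; apply: ler_sum => v _.
  by apply: tilted_weight_clamp.
have sum0 : 0 <= \sum_(0 <= v < n) tilted_weight w x d N v by apply: sumr_ge0.
have N10 : (10 <= N)%N by apply: leq_trans N1000.
have T2 := union_term_le N10 h5 h4 sum0 sumd.
set T := _ * _ / _ in T2 *.
have T0 : 0 <= T.
  apply: divr_ge0 => //; apply: mulr_ge0; last exact: exprn_ge0.
  by apply: prodr_ge0 => j _; exact: atom_ge0.
set m := N.+1 in T2 hm kN2 mR *.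
have m0 : 0 < m%:R :> R by rewrite ltr0n.
have m1 : 1 <= m%:R :> R by rewrite ler1n.
have m4 : 1 <= m%:R ^+ 4 :> R by rewrite exprn_ege1.
have nm : n.+1%:R <= m%:R ^+ 2 :> R.
  rewrite -natrX ler_nat.
  have : (k ^ 2 <= m ^ 2)%N by rewrite leq_sqr.
  by move: kn; clear; lia.
have nm2 : n.+1%:R ^+ 2 <= m%:R ^+ 4 :> R.
  by rewrite (exprM _ 2 2); apply: lerXn2r; rewrite ?nnegrE ?exprn_ge0 // ltW.
have c0 : 0 < n.+1%:R ^+ 2 + 1 :> R by rewrite ltr_pwDr // sqr_ge0.
(* From [n + 1 <= m^2] the union bound costs at most [2 m^4]. Its square [4 m^8] joins the [m^42] of
   [union_term_le], which explains the 4 and the 50 in the hypothesis. *)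
apply: (@le_trans _ _ (2 * m%:R ^+ 4)^-1); last first.
  rewrite lef_pV2 ?posrE //; last by rewrite mulr_gt0 // exprn_gt0.
  lra.
have g0 : 0 < 2 * m%:R ^+ 4 :> R by rewrite mulr_gt0 // exprn_gt0.
rewrite -(@ler_pXn2r _ 2) ?nnegrE ?invr_ge0 ?(ltW g0) //.
apply: (le_trans T2); rewrite exprVn -[leRHS]mul1r ler_pdivlMr ?exprn_gt0 //.
apply: le_trans hm.
have -> : m%:R ^+ 50 = m%:R ^+ 42 * (m%:R ^+ 4) ^+ 2 :> R by rewrite -exprM -exprD.
by rewrite le_eqVlt; apply/orP; left; apply/eqP; ring.
Qed.

(* Imported only here because [Rstruct] shadows [expRD]. *)
From mathcomp Require Import Rstruct.
Local Close Scope ring_scope.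

Theorem theorem1 :
  exists k0 : nat, forall k : nat, k0 <= k ->
    forall n : nat, 1 <= n -> every_graph_has_reg k n -> 9 * k ^ 2 <= 163 * n.
Proof.
pose R : realType := Rdefinitions.R.
have [m0 hm0] := @exp_decay R 4 50 (ler0n _ 4).
(* [m0] makes the exponential beat the polynomial, 1001 gives [N >= 1000] for the clamping, and
   [10 ^+ 14] serves the near and far estimates. *)
exists (maxn m0 (maxn 1001 (Num.bound (10 ^+ 14 : R)))) => k.
rewrite !geq_max => /and3P[km k1000 kb] n _ reg.
rewrite leqNgt; apply/negP => kn.
have hk : (10 ^+ 14 <= k%:R :> R)%R.
  apply: le_trans (ltW (archi_boundP _)) _; first by rewrite exprn_ge0.
  by rewrite ler_nat.
have k0 : 0 < k by apply: leq_trans k1000.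
apply: (@no_regular R (grid_weight R k n) k n k0 _ _ reg) => [v|N d /andP[kN _] dN].
  have /andP[h _] := @grid_weight_bounds R k n v k0 kn.
  by apply: lt_le_trans h; rewrite invr_gt0.
apply: union_term_grid => //.
by apply: hm0; apply: leq_trans kN.
Qed.
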